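(* Let $X$ be a standard Gaussian in $H$ and let $Y$ be a generalized $H$-valued function on $(\mathcal T,\mu)$, with $\mu$ finite. A subcritical GMC $M$ with expectation $\mathbb E M=\mu$ associated to $Y$ is unique (up to almost sure equality), whenever it exists. $M$ can be recovered from $\mu$ and $Y$ as follows: $$M[\mathcal T]=\mathrm{Law}_{\mathbb P\otimes\mu}[X+Y(t)]\,/\,\mathrm{Law}\,X,$$ $$(M[\mathcal T])^{-1}M(x,dt)=\mathrm{Law}_{\mathbb P\otimes\mu}\big[t\in dt\;\big|\;X+Y(t)=x\big],$$ where $\cdots/\mathrm{Law}\,X$ denotes the Radon–Nikodym density with respect to $\mathrm{Law}\,X$, viewed as a function of $X$, and $\mathrm{Law}[\cdot\mid\cdot]$ denotes the conditional distribution.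
   Context: $H$ is a separable infinite-dimensional real Hilbert space with a fixed orthonormal basis $(e_n)$. $(\Omega,\mathcal F,\mathbb P)$ is a standard probability space; $\mathcal T$ is a standard measurable space with measure $\mu$. $L^0(\mathcal T,\mu)$ is the space of $\mu$-equivalence classes of real measurable functions with the topology of convergence in measure. A generalized $H$-valued function on $(\mathcal T,\mu)$ is a continuous linear operator $Y:H\to L^0(\mathcal T,\mu)$; one writes $\langle Y,\xi\rangle\in L^0(\mu)$ for its value at $\xi\in H$ and $\langle Y(t),\xi\rangle$ for the value of that function at $t$. If defined on $(\Omega,\mathbb P)$ it is called a generalized random vector. Its ''value'' $Y(t)$ is identified with the sequence $(\langle Y(t),e_n\rangle)_n\in\mathbb R^{\infty}$ (defined a.e.), and measurability, laws and sums such as $X+Y(t)$ are understood in $\mathbb R^\infty$. A standard Gaussian $X$ in $H$ is a generalized random vector on $(\Omega,\mathbb P)$ such that each $\langle X,\xi\rangle$ is centered Gaussian with variance $\|\xi\|^2$. A random measure on $(\mathcal T,\mu)$ is a random positive finite measure $M$ with $\mathbb E M\ll\mu$, where $(\mathbb E M)[A]:=\mathbb E(M[A])$. A GMC associated to $Y$ (equivalently, over $(X,Y)$) is a random measure $M$ on $(\mathcal T,\mu)$ that is measurable with respect to $X$ (so $M=M(X)$, and $M(X+\xi)$ is well-defined a.s. for $\xi\in H$ by the Cameron–Martin theorem) and such that for every $\xi\in H$, $M(X+\xi,dt)=e^{\langle Y(t),\xi\rangle}M(X,dt)$ a.s. It is subcritical if $\mathbb E M$ is $\sigma$-finite. $\mathrm{Law}_{\mathbb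 P\otimes\mu}[X+Y(t)]$ is the push-forward of $\mathbb P\otimes\mu$ under $(\omega,t)\mapsto X(\omega)+Y(t)\in\mathbb R^\infty$. $\mathrm{Law}_{\mathbb P\otimes\mu}[t\in dt\mid X+Y(t)=x]$ is the regular conditional probability distribution of the projection $(\omega,t)\mapsto t$ given $X+Y(t)=x$ under $\mathbb P\otimes\mu$ (normalized to a probability measure); the second identity is understood for $\mathrm{Law}_{\mathbb P\otimes\mu}[X+Y(t)]$-almost every $x$, and $M(x,dt)$ denotes $M$ as a function of the value $x$ of $X$. *)

(* Defs.v *)
From HB Require Import structures.
From mathcomp Require Import all_boot all_order all_algebra.
From mathcomp Require Import all_classical all_reals all_analysis.
Set Implicit Arguments.
Unset Strict Implicit.
Unset Printing Implicit Defensive.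
Import Order.TTheory GRing.Theory Num.Theory.
Import numFieldNormedType.Exports.
Local Open Scope classical_set_scope.
Local Open Scope ring_scope.

Section Rinf.
Context (R : realType).

Definition coord_preimages : set (set (nat -> R)) :=
  [set A | exists n (B : set R),
    measurable B /\ A = (fun x : nat -> R => x n) @^-1` B].

(* R^oo with its product sigma-algebra. *)
Definition Rinf := g_sigma_algebraType coord_preimages.

HB.instance Definition _ := Measurable.on Rinf.

Lemma measurable_Rinf d (S : measurableType d) (f : S -> Rinf) :
  (forall n, measurable_fun setT (fun s => (f s : nat -> R) n)) ->
  measurable_fun setT f.
Proof.
move=> mf _; rewrite -[measurable]/(<<s coord_preimages >>).
apply: (@measurability _ _ S Rinf setT f coord_preimages (erefl _) _ measurableT).
move=> _ [_ [n [B [mB ->]] <-]]; rewrite setTI.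
by have := mf n measurableT B mB; rewrite setTI.
Qed.

End Rinf.

Definition orthonormal_basis (R : realType) (H : completeNormedModType R)
    (ip : {dot H for idfun}) (e : nat -> H) :=
  (forall i j, ip (e i) (e j) = (i == j)%:R) /\
  (forall u : H, (\sum_(i < n) ip u (e i) *: e i) @[n --> \oo] --> u).

(* T is Borel isomorphic to a Borel subset of the line. *)
Definition standard_measurable_space (R : realType) d (T : measurableType d) :=
  exists f : T -> R, [/\ measurable_fun setT f, injective f &
    forall A, measurable A -> measurable (f @` A)].

(* P is isomorphic mod 0 to a Borel probability on the line, up to completion;
   this covers both Borel probability measures on standard measurable spaces
   and complete Lebesgue-Rokhlin spaces. *)
Definition standard_probability_space (R : realType) d (Omega : measurableType d)
    (P : probability Omega R) :=
  exists (f : Omega -> R) (Omega0 : set Omega),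
    [/\ measurable_fun setT f, measurable Omega0, P Omega0 = 1%E,
        {in Omega0 &, injective f} &
    forall A, measurable A -> A `<=` Omega0 ->
      exists B1 B2 : set R, [/\ measurable B1, measurable B2,
        B1 `<=` f @` A, f @` A `<=` B2 & P (f @^-1` (B2 `\` B1)) = 0%E]].

Section GeneralizedFunctions.
Context (R : realType) (H : completeNormedModType R).

(* {mfun_ mu, T >-> R} is the quotient L^0(mu); its elements are applied through
   a chosen representative.  As mu is finite, the neighbourhoods of the topology
   of convergence in measure are given by the sets {t | eps < |g t - f t|}. *)
Definition generalized_function d (T : measurableType d)
    (mu : {finite_measure set T -> \bar R}) (Y : H -> {mfun_ mu, T >-> R}) :=
  (forall (a : R) (u v : H),
     {ae mu, forall t, Y (a *: u + v) t = a * Y u t + Y v t}) /\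
  (forall (u : H) (eps : R), 0 < eps ->
     mu [set t | eps < `|Y v t - Y u t|] @[v --> u] --> 0%E).

(* normal_prob 0 0 is not the point mass at 0 in the library. *)
Definition centered_gaussian (s : R) : set R -> \bar R :=
  if s == 0 then \d_(0 : R) else normal_prob 0 s.

Definition standard_gaussian d (Omega : measurableType d)
    (P : probability Omega R) (X : H -> {mfun_ P, Omega >-> R}) :=
  generalized_function X /\
  forall (u : H) (B : set R), measurable B ->
    P (X u @^-1` B) = centered_gaussian `|u| B.

Context (e : nat -> H).

Definition value d (T : measurableType d) (mu : {measure set T -> \bar R})
    (Y : H -> {mfun_ mu, T >-> R}) (t : T) : Rinf R := fun n => Y (e n) t.

Section value_measurable.
Context d (T : measurableType d) (mu : {measure set T -> \bar R})
  (Y : H -> {mfun_ mu, T >-> R}).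

Lemma measurable_value : measurable_fun setT (value Y).
Proof.
by apply: measurable_Rinf => n; exact: (measurable_funPT (repr (Y (e n)))).
Qed.

HB.instance Definition _ :=
  isMeasurableFun.Build _ _ _ _ (value Y) measurable_value.

End value_measurable.

Section value_sum.
Context d1 (Omega : measurableType d1) (P : {measure set Omega -> \bar R})
  d2 (T : measurableType d2) (mu : {measure set T -> \bar R})
  (X : H -> {mfun_ P, Omega >-> R}) (Y : H -> {mfun_ mu, T >-> R}).

Definition value_sum (p : Omega * T) : Rinf R :=
  fun n => value X p.1 n + value Y p.2 n.

Lemma measurable_value_sum : measurable_fun setT value_sum.
Proof.
apply: measurable_Rinf => n; apply: measurable_realfun.measurable_funD.
- exact: (measurableT_comp (measurable_funPT (repr (X (e n)))) measurable_fst).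
- exact: (measurableT_comp (measurable_funPT (repr (Y (e n)))) measurable_snd).
Qed.

HB.instance Definition _ :=
  isMeasurableFun.Build _ _ _ _ value_sum measurable_value_sum.

End value_sum.

Section laws.
Context d1 (Omega : measurableType d1) (P : probability Omega R)
  d2 (T : measurableType d2) (mu : {finite_measure set T -> \bar R})
  (X : H -> {mfun_ P, Omega >-> R}) (Y : H -> {mfun_ mu, T >-> R}).

Definition law : set (Rinf R) -> \bar R := distribution P (value X).

HB.instance Definition _ := Probability.on law.

Definition law_sum : set (Rinf R) -> \bar R :=
  pushforward (P \x mu)%E (value_sum X Y).

Let law_sum0 : law_sum set0 = 0%E. Proof. exact: measure0. Qed.

Let law_sum_ge0 A : (0 <= law_sum A)%E. Proof. exact: measure_ge0. Qed.

Let law_sum_sigma_additive : semi_sigma_additive law_sum.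
Proof. exact: measure_semi_sigma_additive. Qed.

HB.instance Definition _ := isMeasure.Build _ _ _ law_sum
  law_sum0 law_sum_ge0 law_sum_sigma_additive.

Let law_sum_fin_num : fin_num_fun law_sum.
Proof.
move=> A mA; rewrite ge0_fin_numE//.
apply: (@le_lt_trans _ _ (law_sum setT)); first by rewrite le_measure ?inE.
rewrite /law_sum /pushforward preimage_setT -setXTT product_measure1E//.
by rewrite lte_mul_pinfty// ?fin_num_measure// -ge0_fin_numE// fin_num_measure.
Qed.

HB.instance Definition _ :=
  Measure_isFinite.Build _ _ _ law_sum law_sum_fin_num.

End laws.

End GeneralizedFunctions.

Section RandomMeasures.
Context (R : realType) d1 (Omega : measurableType d1) (P : probability Omega R)
  d2 (T : measurableType d2).

Definition mean_measure (M : R.-ker Omega ~> T) (A : set T) : \bar R :=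
  (\int[P]_w M w A)%E.

Definition random_measure (mu : {finite_measure set T -> \bar R})
    (M : R.-ker Omega ~> T) :=
  {ae P, forall w, (M w setT < +oo)%E} /\ mean_measure M `<< mu.

Definition subcritical (M : R.-ker Omega ~> T) :=
  sigma_finite setT (mean_measure M).

Definition as_equal (M M' : R.-ker Omega ~> T) :=
  {ae P, forall w, forall A, measurable A -> M w A = M' w A}.

End RandomMeasures.

(* k is a regular conditional distribution of W given Z under nu; the total mass
   of the finite measure nu is irrelevant. *)
Definition conditional_distribution (R : realType) d d1 d2
    (S : measurableType d) (E : measurableType d1) (T : measurableType d2)
    (nu : set S -> \bar R) (W : S -> T) (Z : S -> E) (k : R.-pker E ~> T) :=
  forall (A : set T) (B : set E), measurable A -> measurable B ->
    nu (W @^-1` A `&` Z @^-1` B) = (\int[pushforward nu Z]_(x in B) k x A)%E.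

Section GMC.
Context (R : realType) (H : completeNormedModType R) (ip : {dot H for idfun})
  (e : nat -> H) d1 (Omega : measurableType d1) (P : probability Omega R)
  d2 (T : measurableType d2) (mu : {finite_measure set T -> \bar R})
  (X : H -> {mfun_ P, Omega >-> R}) (Y : H -> {mfun_ mu, T >-> R}).

Definition shift (x : Rinf R) (xi : H) : Rinf R := fun n => x n + ip xi (e n).

(* M = M(X) almost surely, with m the map x |-> M(x). *)
Definition function_of_X (M : R.-ker Omega ~> T) (m : R.-ker (Rinf R) ~> T) :=
  {ae P, forall w, forall A, measurable A -> M w A = m (value e X w) A}.

(* By the Cameron-Martin theorem the shift equation does not depend on the
   choice of m. *)
Definition gmc (M : R.-ker Omega ~> T) :=
  random_measure P mu M /\
  exists2 m : R.-ker (Rinf R) ~> T, function_of_X M m &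
    forall xi : H, {ae P, forall w, forall A, measurable A ->
      m (shift (value e X w) xi) A =
      (\int[m (value e X w)]_(t in A) (expR (Y xi t))%:E)%E}.

End GMC.

(* Main.v *)
Require Import Defs.
From HB Require Import structures.
From mathcomp Require Import all_boot all_order all_algebra.
From mathcomp Require Import all_classical all_reals all_analysis measurable_realfun.
From mathcomp Require Import ring lra.
Set Implicit Arguments.
Unset Strict Implicit.
Unset Printing Implicit Defensive.
Import Order.TTheory GRing.Theory Num.Theory.
Import numFieldNormedType.Exports.
Local Open Scope classical_set_scope.
Local Open Scope ring_scope.
Local Open Scope charge_scope.

(** The theorem rests on one identity: for a subcritical GMC [M] with mean
    [mu], a measurable [A] in the parameter space and a Borel set [D] of
    sequences,
<<
      E [M(A) ; X in D] = (P x mu) {(w, t) | t in A, X(w) + Y(t) in D}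
>>
    ([gmc_law_set]). In words: under the measure [P(dw) M(w, dt)] the point [t]
    has law [mu], and given [t] the field [X] is shifted by [Y(t)]. The
    right-hand side does not involve [M]. Since [M(A)] is a function of [X], its
    integrals over all the events [X in D] determine it almost surely, which is
    uniqueness; [A] equal to the whole space gives the Radon-Nikodym density of
    the law of [X + Y(t)], and dividing by it gives the conditional law of [t].

    The identity comes from exponential moments. For [xi] in [H], the
    Cameron-Martin formula ([cameron_martin]) applied to [x |-> m(x, A)],
    followed by the shift equation of the GMC, yields
<<
      E [M(A) exp <X, xi>] = exp (|xi|^2 / 2) * \int_A exp <Y(t), xi> mu(dt)
>>
    ([gmc_transform]). The right-hand side is also the integral of
    [exp <X + Y(t), xi>] over [t in A] under [P x mu]. So the laws of the first
    [n] coordinates of [X] weighted by [M(A)], and of [X + Y(t)] restricted to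
    [t in A], have the same Laplace transform. It is finite once [A] is cut down
    to a set where the first [n] coordinates of [Y] are bounded; these sets
    exhaust [A] ([ray_law]).

    What remains is that a measure on [R^n] with everywhere finite Laplace
    transform is determined by it ([joint_ray_unique]). In one dimension, call a
    function a multiplier if multiplying by it preserves the equality of the two
    transforms. Multipliers form an algebra, closed under pointwise limits
    dominated by an exponential, that contains the exponentials. Hence it
    contains the identity (a limit of difference quotients of exponentials),
    then [sin ((y - b) t)] (its power series is dominated by an exponential),
    then the indicator of [sin ((y - b) t) < 0] (a bounded limit of polynomials
    in the sine), and, letting [t] tend to 0, the indicator of [y < b]. Several
    coordinates are treated one at a time, the others being absorbed in a
    weight. The Cameron-Martin formula itself follows from the same uniqueness
    result, since both of its sides have explicit Gaussian transforms. *)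

(** * Elementary limits *)

Section real_limits.
Context (R : realType).
Implicit Types u x t b f : R.

Lemma expR_sub1_le u : expR u - 1 <= u * expR u.
Proof.
have h : 1 - u <= expR (- u) by have := expR_ge1Dx (- u).
have := ler_wpM2r (expR_ge0 u) h.
by rewrite -expRD addNr expR0 mulrBl mul1r; lra.
Qed.

Lemma normr_expR_sub1 u : `|expR u - 1| <= `|u| * expR `|u|.
Proof.
have h0 := expR_ge1Dx u; have h1 := expR_sub1_le u.
have [u0|u0] := leP 0 u.
  by rewrite !ger0_norm//; lra.
have e1 : expR u <= 1 by rewrite expR_le1 ltW.
have e2 : 1 <= expR (- u) by rewrite -expR0 ler_expR; lra.
rewrite (ltr0_norm u0) ler0_norm; last by lra.
rewrite (@le_trans _ _ (- u))//; first by lra.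
by rewrite ler_peMr//; lra.
Qed.

Lemma cvg_expR_slope x :
  n.+1%:R * (expR (x / n.+1%:R) - 1) @[n --> \oo] --> x.
Proof.
set c := x ^+ 2 * expR `|x|.
apply: (@squeeze_cvgr _ _ _ _ (cst x) (fun n => x + c * harmonic n)).
- near=> n.
  have n0 : 0 < n.+1%:R :> R by rewrite ltr0n.
  set u := x / n.+1%:R.
  have xE : x = n.+1%:R * u by rewrite /u mulrC divfK// gt_eqF.
  have ux : `|u| <= `|x|.
    rewrite /u normrM normfV (ger0_norm (ltW n0)) ler_pdivrMr//.
    by rewrite ler_peMr// ler1n.
  have h0 := expR_ge1Dx u; have h1 := expR_sub1_le u.
  have h2 := normr_expR_sub1 u.
  have h3 : expR u - 1 - u <= u ^+ 2 * expR `|x|.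
    apply: (@le_trans _ _ (`|u * (expR u - 1)|)).
      by apply: le_trans (ler_norm _); lra.
    rewrite normrM -(real_normK (num_real u)) expr2 -mulrA ler_wpM2l//.
    by apply: (le_trans h2); rewrite ler_wpM2l// ler_expR.
  rewrite {1}xE ler_pM2l//= -lerBlDl.
  have -> : x + c * n.+1%:R^-1 = n.+1%:R * (u + u ^+ 2 * expR `|x|).
    by rewrite /c /u; field; rewrite nat1r gt_eqF.
  by rewrite ler_pM2l// ; apply/andP; split; lra.
- exact: cvg_cst.
- rewrite -[X in _ --> X]addr0 -(mulr0 c); apply: cvgD; first exact: cvg_cst.
  by apply: cvgMr; exact: cvg_harmonic.
Unshelve. all: by end_near. Qed.

Lemma series_sin_coeff_le x n : `|series (sin_coeff x) n| <= expR `|x|.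
Proof.
apply: le_trans (nondecreasing_cvgn_le _ (is_cvg_series_exp_coeff `|x|) n).
  rewrite /series; apply: (le_trans (ler_norm_sum _ _ _)); apply: ler_sum => i _.
  rewrite /exp_coeff /sin_coeff /=.
  rewrite !normrM normfV !normr_nat !normrX normrN normr1 expr1n mulr1.
  by case: odd; rewrite ?mul1r// !mul0r divr_ge0// exprn_ge0.
by apply: nondecreasing_series => i _ _; exact: exp_coeff_ge0.
Qed.

Lemma bernoulli_ineq u n : 0 <= u <= 1 -> 1 - n%:R * u <= (1 - u) ^+ n.
Proof.
move=> /andP[u0 u1]; elim: n => [|n ih]; first by rewrite mul0r subr0 expr0.
rewrite exprS -natr1; have := ler_wpM2l (_ : 0 <= 1 - u) ih.
rewrite subr_ge0 => /(_ u1); apply: le_trans.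
have : 0 <= n%:R * (u * u) by rewrite !mulr_ge0.
by lra.
Qed.

Lemma cvg_natr_expr x : 0 <= x < 1 -> n%:R * x ^+ n @[n --> \oo] --> (0 : R).
Proof.
move=> /andP[x0 x1]; set c := 1 - x.
have c0 : 0 < c by rewrite /c; lra.
rewrite -cvg_shiftS /=.
apply: (@squeeze_cvgr _ _ _ _ (cst 0) (fun n => 2 / c ^+ 2 * harmonic n)).
- near=> n; apply/andP; split; first by rewrite mulr_ge0// exprn_ge0.
  have n0 : 0 < n.+1%:R :> R by rewrite ltr0n.
  (* compare with the quadratic term of [exp (c n)], as [x <= exp (- c)] *)
  have xe : x <= expR (- c) by apply: le_trans (expR_ge1Dx _); rewrite /c; lra.
  have : x ^+ n.+1 <= expR (- (c * n.+1%:R)).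
    by rewrite -mulNr expRM_natr lerXn2r// nnegrE// expR_ge0.
  move=> /(ler_wpM2l (ltW n0))/le_trans; apply.
  have cn : 0 <= c * n.+1%:R by rewrite mulr_ge0// ltW.
  have := expR_ge1Dxn 1 cn; rewrite (_ : 2`! = 2)%N// => h.
  rewrite expRN /= ler_pdivrMr ?expR_gt0//.
  have e0 : 0 <= 2 / c ^+ 2 / n.+1%:R by rewrite !divr_ge0// exprn_ge0// ltW.
  have := ler_wpM2l e0 h; apply: le_trans.
  rewrite mulrDr (_ : 2 / c ^+ 2 / n.+1%:R * ((c * n.+1%:R) ^+ 2 / 2) = n.+1%:R).
    by rewrite mulr1 lerDr.
  by field; rewrite nat1r !gt_eqF.
- exact: cvg_cst.
- rewrite -[X in _ --> X](mulr0 (2 / c ^+ 2)).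
  by apply: cvgMr; exact: cvg_harmonic.
Unshelve. all: by end_near. Qed.

(** Bernoulli's inequality gives the limit when [f < 1/2], since [n (2 f)^n]
    tends to 0, and [1 - x <= exp (- x)] gives it otherwise; the factor [n] in the
    exponent makes the value at [f = 1/2] tend to 0 as well. *)
Lemma cvg_indic_lt_half f : 0 <= f <= 1 ->
  (1 - f ^+ n) ^+ (n * 2 ^ n) @[n --> \oo] --> ((f < 2^-1)%R%:R : R).
Proof.
move=> /andP[f0 f1].
have fn01 n : 0 <= f ^+ n <= 1 by rewrite exprn_ge0//= exprn_ile1.
have nf n : (n * 2 ^ n)%:R * f ^+ n = n%:R * (2 * f) ^+ n.
  by rewrite natrM natrX exprMn mulrA.
have [f2|f2] := ltP f 2^-1.
- apply: (@squeeze_cvgr _ _ _ _ (fun n => 1 - n%:R * (2 * f) ^+ n) (cst 1)).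
  + near=> n; rewrite -nf bernoulli_ineq//=; apply: exprn_ile1.
      by rewrite subr_ge0; have /andP[] := fn01 n.
    by rewrite gerBl; have /andP[] := fn01 n.
  + rewrite -[X in _ --> X]subr0; apply: cvgB; first exact: cvg_cst.
    by apply: cvg_natr_expr; lra.
  + exact: cvg_cst.
- apply: (@squeeze_cvgr _ _ _ _ (cst 0) (fun n => expR (- n%:R))).
  + near=> n; have /andP[h0 h1] := fn01 n.
    rewrite exprn_ge0 ?subr_ge0//=.
    apply: (@le_trans _ _ (expR (- (f ^+ n)) ^+ (n * 2 ^ n))).
      by rewrite lerXn2r ?nnegrE ?subr_ge0 ?expR_ge0//; exact: expR_ge1Dx.
    rewrite -expRM_natl mulrN nf ler_expR lerN2 ler_peMr// exprn_ege1//; lra.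
  + exact: cvg_cst.
  + exact: cvgn_expR.
Unshelve. all: by end_near. Qed.

(** As soon as [|x - b| < (n + 1) pi], the sine has the sign of [x - b]. *)
Lemma cvg_sin_sign x b :
  ((sin ((x - b) / n.+1%:R) < 0)%R%:R : R) @[n --> \oo] --> ((x < b)%R%:R : R).
Proof.
apply: cvg_near_cst; near=> n.
have n0 : 0 < n.+1%:R :> R by rewrite ltr0n.
have npi : `|x - b| / n.+1%:R < pi.
  rewrite ltr_pdivrMr// -ltr_pdivrMl ?pi_gt0//.
  apply: (@lt_trans _ _ n%:R); last by rewrite ltr_nat.
  by near: n; exact: nbhs_infty_gtr.
have [xb|xb|->] := ltrgtP x b.
- have : 0 < sin ((b - x) / n.+1%:R).
    apply: sin_gt0_pi; rewrite divr_gt0 ?subr_gt0//=.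
    by rewrite -(ger0_norm (_ : 0 <= b - x)) ?subr_ge0 ?ltW// distrC.
  by rewrite -opprB mulNr sinN oppr_gt0 => ->.
- have : 0 < sin ((x - b) / n.+1%:R).
    apply: sin_gt0_pi; rewrite divr_gt0 ?subr_gt0//=.
    by rewrite -{1}(ger0_norm (_ : 0 <= x - b)) ?subr_ge0 ?ltW.
  by move=> h; rewrite ltNge (ltW h).
- by rewrite subrr mul0r sin0 ltxx.
Unshelve. all: by end_near. Qed.

End real_limits.

(** * Uniqueness of Laplace transforms on the line *)

Section exp_dominated.
Context (R : realType).
Implicit Types h g : R -> R.

Definition exp_bounded h C c := forall y, `|h y| <= C * expR (c * `|y|).

Definition exp_dominated h :=
  measurable_fun setT h /\ exists C c, exp_bounded h C c.

Lemma exp_bounded_ge0 h C c : exp_bounded h C c -> 0 <= C.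
Proof.
move=> /(_ 0); rewrite normr0 mulr0 expR0 mulr1; exact: le_trans.
Qed.

Lemma exp_boundedM h g C c C' c' : exp_bounded h C c -> exp_bounded g C' c' ->
  exp_bounded (h \* g) (C * C') (c + c').
Proof.
move=> hb gb y /=; rewrite normrM mulrDl expRD mulrACA.
by apply: ler_pM.
Qed.

Lemma exp_dominatedM h g :
  exp_dominated h -> exp_dominated g -> exp_dominated (h \* g).
Proof.
move=> [mh [C [c hb]]] [mg [C' [c' gb]]]; split; first exact: measurable_funM.
by exists (C * C'), (c + c'); exact: exp_boundedM.
Qed.

Lemma exp_dominatedD h g :
  exp_dominated h -> exp_dominated g -> exp_dominated (h \+ g).
Proof.
move=> [mh [C [c hb]]] [mg [C' [c' gb]]]; split; first exact: measurable_funD.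
exists (C + C'), (Num.max c c') => y /=.
apply: (le_trans (ler_normD _ _)); rewrite mulrDl; apply: lerD.
  apply: (le_trans (hb y)); rewrite ler_wpM2l ?(exp_bounded_ge0 hb)//.
  by rewrite ler_expR ler_wpM2r// le_max lexx.
apply: (le_trans (gb y)); rewrite ler_wpM2l ?(exp_bounded_ge0 gb)//.
by rewrite ler_expR ler_wpM2r// le_max lexx orbT.
Qed.

Lemma exp_dominated_cst r : exp_dominated (cst r).
Proof.
split => //; exists `|r|, 0 => y.
by rewrite mul0r expR0 mulr1.
Qed.

Lemma exp_dominated_expR a : exp_dominated (fun y => expR (a * y)).
Proof.
split; first exact: measurableT_comp.
exists 1, `|a| => y; rewrite mul1r ger0_norm ?expR_ge0// ler_expR.
by rewrite -normrM ler_norm.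
Qed.

Lemma exp_dominated_lim (h_ : nat -> R -> R) h C c :
  (forall n, measurable_fun setT (h_ n)) ->
  (forall n, exp_bounded (h_ n) C c) ->
  (forall y, h_ n y @[n --> \oo] --> h y) -> exp_dominated h.
Proof.
move=> mh hb hl; split.
  by apply: (measurable_fun_cvg mh) => y _; exact: hl.
exists C, c => y; apply: (cvgr_to_le (cvg_norm (hl y))).
by apply: nearW => n; exact: hb.
Qed.

End exp_dominated.

Section weighted_integral.
Context (R : realType) d (S : measurableType d) (rho : {measure set S -> \bar R})
  (w f : S -> R).
Context (mw : measurable_fun setT w) (mf : measurable_fun setT f)
  (w0 : forall x, 0 <= w x)
  (mgf : forall a, (\int[rho]_x (w x * expR (a * f x))%:E < +oo)%E).
Implicit Types h g : R -> R.

Let measurable_comp_weight h : measurable_fun setT h ->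
  measurable_fun setT (fun x => w x * h (f x)).
Proof.
by move=> mh; apply: measurable_funM => //; exact: measurableT_comp.
Qed.

Lemma integrable_weight_bound C c : rho.-integrable setT
  (EFin \o (fun x => w x * (C * (expR (c * f x) + expR (- c * f x))))).
Proof.
have E a : rho.-integrable setT (EFin \o (fun x => w x * expR (a * f x))).
  apply/integrableP; split.
    by apply/measurable_EFinP/(measurable_comp_weight (exp_dominated_expR a).1).
  under eq_integral do rewrite gee0_abs ?lee_fin ?mulr_ge0 ?expR_ge0//.
  exact: mgf.
have := integrableZl measurableT C (integrableD measurableT (E c) (E (- c))).
congr (integrable _ _ _); apply/funext => x /=.
by rewrite -EFinM -mulrDr; congr EFin; rewrite mulrCA.
Qed.

Lemma weight_le h C c x : exp_bounded h C c ->
  `|w x * h (f x)| <= w x * (C * (expR (c * f x) + expR (- c * f x))).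
Proof.
move=> hb; rewrite normrM (ger0_norm (w0 x)) ler_wpM2l//.
apply: (le_trans (hb _)); rewrite ler_wpM2l ?(exp_bounded_ge0 hb)//.
have [f0|f0] := leP 0 (f x).
  by rewrite ger0_norm// lerDl expR_ge0.
by rewrite ltr0_norm// mulrN -mulNr lerDr expR_ge0.
Qed.

Lemma integrable_weight h : exp_dominated h ->
  rho.-integrable setT (EFin \o (fun x => w x * h (f x))).
Proof.
move=> [mh [C [c hb]]]; apply: le_integrable (integrable_weight_bound C c) => //.
  exact/measurable_EFinP/measurable_comp_weight.
by move=> x _ /=; rewrite lee_fin (le_trans (weight_le x hb))// ler_norm.
Qed.

Definition weighted_integral h := \int[rho]_x (w x * h (f x)).
Local Notation I := weighted_integral.

Lemma weighted_integralD h g : exp_dominated h -> exp_dominated g ->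
  I (h \+ g) = I h + I g.
Proof.
move=> hd gd; rewrite /I -RintegralD//; try exact: integrable_weight.
by apply: eq_Rintegral => x _ /=; rewrite mulrDr.
Qed.

Lemma weighted_integralZ r h : exp_dominated h -> I (fun y => r * h y) = r * I h.
Proof.
move=> hd; rewrite /I -RintegralZl//; last exact: integrable_weight.
by apply: eq_Rintegral => x _ /=; rewrite mulrCA.
Qed.

(** A common bound [C exp (c |y|)] is integrable because the transform is finite
    at both [c] and [- c], so this is dominated convergence. *)
Lemma cvg_weighted_integral (h_ : nat -> R -> R) h C c :
  (forall n, measurable_fun setT (h_ n)) ->
  (forall n, exp_bounded (h_ n) C c) ->
  (forall y, h_ n y @[n --> \oo] --> h y) ->
  I (h_ n) @[n --> \oo] --> I h.
Proof.
move=> mh hb hl; have hd := exp_dominated_lim mh hb hl.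
have [|||||_ _] := @dominated_convergence _ _ _ rho setT measurableT
  (fun n => EFin \o (fun x => w x * h_ n (f x)))
  (EFin \o (fun x => w x * h (f x)))
  (EFin \o (fun x => w x * (C * (expR (c * f x) + expR (- c * f x))))).
- by move=> n; exact/measurable_EFinP/measurable_comp_weight.
- by apply/measurable_EFinP/measurable_comp_weight; case: hd.
- apply: aeW => x _; apply: cvg_EFin; first exact: nearW.
  by apply: cvgMr; exact: hl.
- exact: integrable_weight_bound.
- by apply: aeW => x n _; rewrite lee_fin; exact: weight_le.
move=> cv; apply: fine_cvg; rewrite fineK//; apply: integrable_fin_num => //.
exact: integrable_weight.
Qed.

End weighted_integral.

Section exponential_algebra.
Context (R : realType)
  d1 (S1 : measurableType d1) (rho1 : {measure set S1 -> \bar R}) (w1 f1 : S1 -> R)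
  d2 (S2 : measurableType d2) (rho2 : {measure set S2 -> \bar R}) (w2 f2 : S2 -> R).
Context (mw1 : measurable_fun setT w1) (mf1 : measurable_fun setT f1)
  (w1_ge0 : forall x, 0 <= w1 x)
  (mgf1 : forall a, (\int[rho1]_x (w1 x * expR (a * f1 x))%:E < +oo)%E).
Context (mw2 : measurable_fun setT w2) (mf2 : measurable_fun setT f2)
  (w2_ge0 : forall x, 0 <= w2 x)
  (mgf2 : forall a, (\int[rho2]_x (w2 x * expR (a * f2 x))%:E < +oo)%E).
Context (mgf12 : forall a, (\int[rho1]_x (w1 x * expR (a * f1 x))%:E =
                            \int[rho2]_x (w2 x * expR (a * f2 x))%:E)%E).
Implicit Types h g : R -> R.

Local Notation I1 := (weighted_integral rho1 w1 f1).
Local Notation I2 := (weighted_integral rho2 w2 f2).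

Definition same_transform h := exp_dominated h /\
  forall a, I1 (h \* (fun y => expR (a * y))) = I2 (h \* (fun y => expR (a * y))).

(** Products of functions in [same_transform] need not stay in it, whereas
    multipliers form an algebra, which is what polynomials and power series
    require. *)
Definition multiplier g := forall h, same_transform h -> same_transform (h \* g).

Lemma same_transform1 : same_transform (cst 1).
Proof.
split=> [|a]; first exact: exp_dominated_cst.
rewrite /weighted_integral /Rintegral; congr fine.
under eq_integral do rewrite /= mul1r.
by rewrite mgf12; apply: eq_integral => x _ /=; rewrite mul1r.
Qed.

Lemma same_transformD h g :
  same_transform h -> same_transform g -> same_transform (h \+ g).
Proof.
move=> [hd hE] [gd gE]; split=> [|a]; first exact: exp_dominatedD.
have -> : (h \+ g) \* (fun y => expR (a * y)) =
    (h \* (fun y => expR (a * y))) \+ (g \* (fun y => expR (a * y))).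
  by apply/funext => y /=; rewrite mulrDl.
have ed := exp_dominated_expR a.
by rewrite !weighted_integralD ?hE ?gE//; exact: exp_dominatedM.
Qed.

Lemma multiplier_expR a : multiplier (fun y => expR (a * y)).
Proof.
move=> h [hd hE]; split=> [|b].
  by apply: exp_dominatedM => //; exact: exp_dominated_expR.
have -> : (h \* (fun y => expR (a * y))) \* (fun y => expR (b * y)) =
    h \* (fun y => expR ((a + b) * y)).
  by apply/funext => y /=; rewrite -mulrA -expRD -mulrDl.
exact: hE.
Qed.

Lemma multiplier_cst r : multiplier (cst r).
Proof.
move=> h [hd hE]; split=> [|a].
  by apply: exp_dominatedM => //; exact: exp_dominated_cst.
have -> : (h \* cst r) \* (fun y => expR (a * y)) =
    (fun y => r * (h \* (fun y => expR (a * y))) y).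
  by apply/funext => y /=; rewrite -mulrA mulrCA.
have ed := exp_dominated_expR a.
by rewrite !weighted_integralZ ?hE//; exact: exp_dominatedM.
Qed.

Lemma multiplierD g g' : multiplier g -> multiplier g' -> multiplier (g \+ g').
Proof.
move=> mg mg' h hK.
rewrite (_ : h \* _ = (h \* g) \+ (h \* g')).
  by apply: same_transformD; [exact: mg|exact: mg'].
by apply/funext => y /=; rewrite mulrDr.
Qed.

Lemma multiplierM g g' : multiplier g -> multiplier g' -> multiplier (g \* g').
Proof.
move=> mg mg' h hK.
rewrite (_ : h \* _ = (h \* g) \* g'); first exact/mg'/mg.
by apply/funext => y /=; rewrite mulrA.
Qed.

Lemma multiplierX g n : multiplier g -> multiplier (fun y => g y ^+ n).
Proof.
move=> mg; elim: n => [|n ih]; first exact: (multiplier_cst 1).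
by under [X in multiplier X]funext do rewrite exprS; exact: multiplierM.
Qed.

Lemma multiplier_sum (g_ : nat -> R -> R) n : (forall i, multiplier (g_ i)) ->
  multiplier (fun y => \sum_(0 <= i < n) g_ i y).
Proof.
move=> mg; elim: n => [|n ih].
  under [X in multiplier X]funext do rewrite big_geq//.
  exact: (multiplier_cst 0).
under [X in multiplier X]funext do rewrite big_nat_recr//=.
exact: multiplierD.
Qed.

(** Exponentially dominated limits commute with both integrals. *)
Lemma multiplier_lim (g_ : nat -> R -> R) g C c :
  (forall n, multiplier (g_ n)) -> (forall n, exp_bounded (g_ n) C c) ->
  (forall y, g_ n y @[n --> \oo] --> g y) -> multiplier g.
Proof.
move=> mg gb gl h hK; have [hd hE] := hK.
have mg_ n : measurable_fun setT (g_ n).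
  have [[+ _] _] := mg n _ same_transform1.
  by congr measurable_fun; apply/funext => y /=; rewrite mul1r.
split=> [|a].
  by apply: exp_dominatedM => //; exact: (exp_dominated_lim mg_ gb gl).
have [mh [Ch [ch hb]]] := hd.
have [me [Ce [ce eb]]] := exp_dominated_expR a.
have mk n : measurable_fun setT ((h \* g_ n) \* (fun y => expR (a * y))).
  by apply: measurable_funM => //; exact: measurable_funM.
have kb n := exp_boundedM (exp_boundedM hb (gb n)) eb.
have kl y : ((h \* g_ n) \* (fun y => expR (a * y))) y @[n --> \oo] -->
    ((h \* g) \* (fun y => expR (a * y))) y.
  by apply: cvgMl; apply: cvgMr; exact: gl.
have c1 := cvg_weighted_integral mw1 mf1 w1_ge0 mgf1 mk kb kl.
have c2 := cvg_weighted_integral mw2 mf2 w2_ge0 mgf2 mk kb kl.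
apply: (cvg_unique _ c1) => //; apply: cvg_trans c2.
by apply: near_eq_cvg; apply: nearW => n; have [_ ->] := mg n h hK.
Qed.

(** The identity is the limit of [(n + 1) (exp (y / (n + 1)) - 1)], and these
    are bounded by [|y| exp |y|]. *)
Lemma multiplier_id : multiplier id.
Proof.
apply: (@multiplier_lim (fun n y => n.+1%:R * (expR (y / n.+1%:R) - 1)) _ 1 2).
- move=> n; apply: multiplierM; first exact: multiplier_cst.
  apply: multiplierD; last exact: (multiplier_cst (-1)).
  have := @multiplier_expR n.+1%:R^-1.
  by congr multiplier; apply/funext => y; rewrite mulrC.
- move=> n y; rewrite mul1r.
  have n0 : 0 < n.+1%:R :> R by rewrite ltr0n.
  rewrite normrM (ger0_norm (ltW n0)).
  apply: (@le_trans _ _ (`|y| * expR `|y|)).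
    apply: (@le_trans _ _ (n.+1%:R * (`|y / n.+1%:R| * expR `|y / n.+1%:R|))).
      by rewrite ler_pM2l//; exact: normr_expR_sub1.
    have -> : `|y / n.+1%:R| = `|y| / n.+1%:R.
      by rewrite normrM normfV (ger0_norm (ltW n0)).
    rewrite mulrA mulrCA divff ?gt_eqF// mulr1 ler_wpM2l// ler_expR.
    by rewrite ler_pdivrMr// ler_peMr// ler1n.
  rewrite (_ : 2 * `|y| = `|y| + `|y|) ?expRD ?ler_wpM2r ?expR_ge0//; last by lra.
  by have := expR_ge1Dx `|y|; lra.
- by move=> y; exact: cvg_expR_slope.
Qed.

(** The partial sums of the power series of the sine at [(y - b) t] are bounded
    by [exp (|b| |t|) exp (|t| |y|)]. *)
Lemma multiplier_sin t b : multiplier (fun y => sin ((y - b) * t)).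
Proof.
apply: (@multiplier_lim (fun n y => series (sin_coeff ((y - b) * t)) n) _
  (expR (`|b| * `|t|)) `|t|).
- move=> n; apply: multiplier_sum => i; rewrite /sin_coeff /=.
  apply: multiplierM; last exact: multiplier_cst.
  apply: multiplierM; first exact: multiplier_cst.
  apply: multiplierX; apply: multiplierM; last exact: multiplier_cst.
  by apply: multiplierD; [exact: multiplier_id|exact: (multiplier_cst (- b))].
- move=> n y; apply: (le_trans (series_sin_coeff_le _ _)).
  rewrite -expRD ler_expR normrM [`|t| * _]mulrC -mulrDl ler_wpM2r//.
  by rewrite [leRHS]addrC; exact: ler_normB.
- by move=> y; rewrite unlock; exact: is_cvg_series_sin_coeff.
Qed.

(** With [F = (1 + sin) / 2], which lies in [[0, 1]], the polynomials
    [(1 - F^n)^(n 2^n)] tend to the indicator of [F < 1/2]. *)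
Lemma multiplier_sin_lt0 t b :
  multiplier (fun y => (sin ((y - b) * t) < 0)%R%:R).
Proof.
pose F y : R := (1 + sin ((y - b) * t)) / 2.
have F01 y : 0 <= F y <= 1.
  by have := sin_geN1 ((y - b) * t); have := sin_le1 ((y - b) * t);
     rewrite /F => ? ?; apply/andP; split; lra.
apply: (@multiplier_lim (fun n y => (1 - F y ^+ n) ^+ (n * 2 ^ n)) _ 1 0).
- move=> n; apply: multiplierX; apply: multiplierD; first exact: multiplier_cst.
  under [X in multiplier X]funext do rewrite -mulN1r.
  apply: multiplierM; first exact: multiplier_cst.
  apply: multiplierX; apply: multiplierM; last exact: multiplier_cst.
  by apply: multiplierD; [exact: multiplier_cst|exact: multiplier_sin].
- move=> n y; rewrite mul0r expR0 mulr1.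
  have /andP[F0 F1] := F01 y.
  have Fn0 : 0 <= F y ^+ n by rewrite exprn_ge0.
  have Fn1 : F y ^+ n <= 1 by rewrite exprn_ile1.
  by rewrite ger0_norm ?exprn_ge0 ?exprn_ile1 ?subr_ge0// gerBl.
- move=> y; rewrite (_ : (sin _ < 0) = (F y < 2^-1)); first exact: cvg_indic_lt_half.
  by rewrite /F; apply/idP/idP; lra.
Qed.

Lemma multiplier_lt b : multiplier (fun y => (y < b)%R%:R).
Proof.
apply: (@multiplier_lim (fun n y => (sin ((y - b) / n.+1%:R) < 0)%R%:R) _ 1 0).
- by move=> n; exact: multiplier_sin_lt0.
- by move=> n y; rewrite mul0r expR0 mulr1 normr_nat; case: (sin _ < 0).
- by move=> y; exact: cvg_sin_sign.
Qed.

Lemma weighted_ray_unique b :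
  (\int[rho1]_x (w1 x * (f1 x < b)%R%:R)%:E =
   \int[rho2]_x (w2 x * (f2 x < b)%R%:R)%:E)%E.
Proof.
have [hd] := multiplier_lt b same_transform1.
have h (y : R) : (cst 1 \* (fun y => (y < b)%R%:R)) y * expR (0 * y) =
    (y < b)%R%:R :> R.
  by rewrite /= mul0r expR0 mulr1 mul1r.
move=> /(_ 0); rewrite /weighted_integral.
have i1 := integrable_weight mw1 mf1 w1_ge0 mgf1 hd.
have i2 := integrable_weight mw2 mf2 w2_ge0 mgf2 hd.
rewrite /Rintegral; under eq_integral do rewrite /= h.
under [X in _ = fine X]eq_integral do rewrite /= h.
move=> E.
have e1 : (\int[rho1]_x (w1 x * (f1 x < b)%R%:R)%:E \is a fin_num)%E.
  have := integrable_fin_num measurableT i1.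
  by under eq_integral do rewrite /= mul1r.
have e2 : (\int[rho2]_x (w2 x * (f2 x < b)%R%:R)%:E \is a fin_num)%E.
  have := integrable_fin_num measurableT i2.
  by under eq_integral do rewrite /= mul1r.
by rewrite -(fineK e1) -(fineK e2) E.
Qed.

End exponential_algebra.

(** * Uniqueness of Laplace transforms in several variables *)

Section joint_transform.
Context (R : realType) d1 (S1 : measurableType d1) (rho1 : {measure set S1 -> \bar R})
  d2 (S2 : measurableType d2) (rho2 : {measure set S2 -> \bar R}).
Context (f1 : nat -> S1 -> R) (f2 : nat -> S2 -> R)
  (mf1 : forall i, measurable_fun setT (f1 i))
  (mf2 : forall i, measurable_fun setT (f2 i)).

(** Induction on the number of coordinates: with the exponentials of the first
    [n] coordinates absorbed in the weight, the one-dimensional result replaces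
    the exponential of the last coordinate by the indicator of a half-line, which
    then joins the weight. *)
Lemma joint_ray_unique n (w1 : S1 -> R) (w2 : S2 -> R) :
  measurable_fun setT w1 -> measurable_fun setT w2 ->
  (forall x, 0 <= w1 x) -> (forall x, 0 <= w2 x) ->
  (forall a : nat -> R,
    (\int[rho1]_x (w1 x * expR (\sum_(i < n) a i * f1 i x))%:E < +oo)%E) ->
  (forall a : nat -> R,
    (\int[rho1]_x (w1 x * expR (\sum_(i < n) a i * f1 i x))%:E =
     \int[rho2]_x (w2 x * expR (\sum_(i < n) a i * f2 i x))%:E)%E) ->
  forall b : nat -> R,
    (\int[rho1]_x (w1 x * \prod_(i < n) (f1 i x < b i)%R%:R)%:E =
     \int[rho2]_x (w2 x * \prod_(i < n) (f2 i x < b i)%R%:R)%:E)%E.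
Proof.
elim: n w1 w2 => [|n ih] w1 w2 mw1 mw2 w10 w20 fin eq12 b.
  have := eq12 b.
  under eq_integral do rewrite big_ord0 expR0.
  under [X in _ = X -> _]eq_integral do rewrite big_ord0 expR0.
  under [X in _ -> X = _]eq_integral do rewrite big_ord0.
  by under [X in _ -> _ = X]eq_integral do rewrite big_ord0.
have mE d (T : measurableType d) (f : nat -> T -> R) (a : nat -> R) :
    (forall i, measurable_fun setT (f i)) ->
    measurable_fun setT (fun x => expR (\sum_(i < n) a i * f i x)).
  move=> mf; apply: measurableT_comp => //; apply: measurable_sum => i.
  exact: measurable_funM.
have mI d (T : measurableType d) (f : nat -> T -> R) :
    (forall i, measurable_fun setT (f i)) ->
    measurable_fun setT (fun x => (f n x < b n)%R%:R : R).
  move=> mf; rewrite (_ : (fun _ => _) = \1_(f n @^-1` [set y | y < b n])).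
    apply: measurable_indic; rewrite -[X in measurable X]setTI; apply: mf => //.
    have -> : [set y | y < b n] = `]-oo, b n[%classic by rewrite set_itvE.
    exact: measurable_itv.
  apply/funext => x; rewrite indicE; congr (_%:R); congr nat_of_bool.
  by apply/idP/idP; rewrite in_setE.
(* [ext a c] is [a] with [c] as coefficient of the last coordinate *)
pose ext (a : nat -> R) c i := if i == n then c else a i.
have extE (a : nat -> R) c (g : nat -> R) :
    \sum_(i < n.+1) ext a c i * g i = \sum_(i < n) a i * g i + c * g n.
  rewrite big_ord_recr/= /ext eqxx; congr (_ + _).
  by apply: eq_bigr => i _; rewrite ltn_eqF.
have step (a : nat -> R) : (
    \int[rho1]_x (w1 x * expR (\sum_(i < n) a i * f1 i x) * (f1 n x < b n)%R%:R)%:E =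
    \int[rho2]_x (w2 x * expR (\sum_(i < n) a i * f2 i x) * (f2 n x < b n)%R%:R)%:E)%E.
  have E1 c :
    (\int[rho1]_x
       (w1 x * expR (\sum_(i < n) a i * f1 i x) * expR (c * f1 n x))%:E =
     \int[rho1]_x (w1 x * expR (\sum_(i < n.+1) ext a c i * f1 i x))%:E)%E.
    by apply: eq_integral => x _; rewrite (extE a c (f1^~ x)) expRD mulrA.
  have E2 c :
    (\int[rho2]_x
       (w2 x * expR (\sum_(i < n) a i * f2 i x) * expR (c * f2 n x))%:E =
     \int[rho2]_x (w2 x * expR (\sum_(i < n.+1) ext a c i * f2 i x))%:E)%E.
    by apply: eq_integral => x _; rewrite (extE a c (f2^~ x)) expRD mulrA.
  apply: weighted_ray_unique => //.
  - by apply: measurable_funM => //; exact: mE.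
  - by move=> x; rewrite mulr_ge0 ?expR_ge0.
  - by move=> c; rewrite E1; exact: fin.
  - by apply: measurable_funM => //; exact: mE.
  - by move=> x; rewrite mulr_ge0 ?expR_ge0.
  - by move=> c; rewrite E2 -eq12; exact: fin.
  - by move=> c; rewrite E1 E2.
under eq_integral do rewrite big_ord_recr/= mulrA mulrAC.
under [RHS]eq_integral do rewrite big_ord_recr/= mulrA mulrAC.
apply: ih.
- by apply: measurable_funM => //; exact: mI.
- by apply: measurable_funM => //; exact: mI.
- by move=> x; rewrite mulr_ge0.
- by move=> x; rewrite mulr_ge0.
- move=> a; apply: le_lt_trans (fin (ext a 0)).
  apply: ge0_le_integral => //.
  + by move=> x _; rewrite lee_fin !mulr_ge0 ?expR_ge0.
  + apply/measurable_EFinP; apply: measurable_funM; last exact: mE.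
    by apply: measurable_funM => //; exact: mI.
  + apply/measurable_EFinP; apply: measurable_funM => //.
    apply: measurableT_comp => //; apply: measurable_sum => i.
    exact: measurable_funM.
  + move=> x _; rewrite lee_fin (extE a 0 (f1^~ x)) mul0r addr0 ler_wpM2r ?expR_ge0//.
    by rewrite ler_piMr//; case: (_ < _).
- move=> a.
  under eq_integral do rewrite mulrAC.
  under [RHS]eq_integral do rewrite mulrAC.
  exact: step.
Qed.

End joint_transform.

(** * Densities and measures on the space of sequences *)

Section density.
Local Open Scope ereal_scope.
Context (R : realType) d (S : measurableType d).

(** The two hypotheses are arguments so that the finite measure structure can be
    attached to the term [density w0 iw] itself. *)
Definition density (mu : set S -> \bar R) (w : S -> \bar R)
  of (forall x, 0 <= w x) & integrable mu setT w :=
  fun A : set S => \int[mu]_(x in A) w x.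

Section density_measure.
Context (mu : {measure set S -> \bar R}) (w : S -> \bar R).
Context (w0 : forall x, 0 <= w x) (iw : mu.-integrable setT w).

Let density0 : density w0 iw set0 = 0.
Proof. by rewrite /density integral_set0. Qed.

Let density_ge0 A : 0 <= density w0 iw A.
Proof. by rewrite /density integral_ge0. Qed.

Let density_sigma_additive : semi_sigma_additive (density w0 iw).
Proof.
move=> A mA tA mUA.
rewrite /density integral_bigcup//=; last first.
  by apply: (integrableS _ _ (@subsetT _ _) iw).
by apply: is_cvg_ereal_nneg_natsum_cond => n _ _; exact: integral_ge0.
Qed.

HB.instance Definition _ := isMeasure.Build _ _ _ (density w0 iw)
  density0 density_ge0 density_sigma_additive.

Let density_fin_num : fin_num_fun (density w0 iw).
Proof.
move=> A mA; rewrite /density; apply: integrable_fin_num => //.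
exact: (integrableS _ _ (@subsetT _ _) iw).
Qed.

HB.instance Definition _ :=
  Measure_isFinite.Build _ _ _ (density w0 iw) density_fin_num.

End density_measure.

(** The weight agrees almost everywhere with the Radon-Nikodym derivative of the
    measure that it defines. *)
Lemma integral_density (mu : {sigma_finite_measure set S -> \bar R})
    (w g : S -> \bar R) (w0 : forall x, 0 <= w x) (iw : mu.-integrable setT w) :
  measurable_fun setT g -> (forall x, 0 <= g x) ->
  \int[density w0 iw]_x g x = \int[mu]_x (g x * w x).
Proof.
move=> mg g0; have mw := measurable_int _ iw.
have dom : density w0 iw `<< mu.
  apply/null_content_dominatesP => A mA A0; apply: null_set_integral => //.
  exact: measurable_funTS.
rewrite -(Radon_Nikodym_SigmaFinite.change_of_variables dom)//.
have iRN := Radon_Nikodym_SigmaFinite.f_integrable dom.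
have mRN := measurable_int _ iRN.
apply: ae_eq_integral => //; [exact: emeasurable_funM..|].
apply: ae_eqe_mul2l; apply: integral_ae_eq => // A _ mA.
by rewrite -Radon_Nikodym_SigmaFinite.f_integral.
Qed.

End density.

Section Rinf_rays.
Context (R : realType).

Definition ray_cylinder n (b : nat -> R) : set (Rinf R) :=
  [set x : Rinf R | forall i, (i < n)%N -> (x : nat -> R) i < b i].

Definition ray_cylinders : set (set (Rinf R)) :=
  [set A | exists n b, A = ray_cylinder n b].

Lemma measurable_coord n : measurable_fun setT (fun x : Rinf R => (x : nat -> R) n).
Proof.
move=> _ B mB; rewrite setTI; apply: sub_sigma_algebra; exists n, B; split => //.
Qed.

Lemma measurable_ray_cylinder n b : measurable (ray_cylinder n b).
Proof.
rewrite (_ : ray_cylinder n b =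
  \bigcap_(i < n) [set x : Rinf R | (x : nat -> R) i < b i])//.
rewrite bigcap_mkord; apply: bigsetI_measurable => i _.
have := @measurable_coord i measurableT `]-oo, b i[%classic (measurable_itv _).
by rewrite setTI; congr measurable; apply/seteqP; split => x /=; rewrite in_itv.
Qed.

Lemma setI_closed_ray_cylinders : setI_closed ray_cylinders.
Proof.
move=> _ _ [n [b ->]] [n' [b' ->]].
exists (maxn n n'), (fun i => if (i < n)%N then
  if (i < n')%N then Num.min (b i) (b' i) else b i else b' i).
apply/seteqP; split => x /=.
  move=> [h h'] i; rewrite leq_max => /orP[] li; rewrite li.
    by case: ifP => li'; rewrite ?lt_min h//= h'.
  by case: ifP => li'; rewrite ?lt_min h'//= h.
move=> h; split => i li; have := h i; rewrite leq_max li ?orbT => /(_ isT).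
  by case: ifP => // _; rewrite lt_min => /andP[].
by case: ifP => // _; rewrite lt_min => /andP[].
Qed.

(** A single coordinate half-line is not a cylinder of this form, because every
    earlier coordinate is bounded too; it is the union of the cylinders whose
    earlier bounds are [N]. *)
Lemma measurable_Rinf_rays : @measurable _ (Rinf R) = <<s ray_cylinders >>.
Proof.
apply/seteqP; split; last first.
  apply: smallest_sub; first exact: sigma_algebra_measurable.
  by move=> _ [n [b ->]]; exact: measurable_ray_cylinder.
rewrite -[measurable]/(<<s coord_preimages (R:=R) >>).
apply: smallest_sub; first exact: smallest_sigma_algebra.
move=> _ [n [B [mB ->]]].
suff : measurable_fun setT
    (fun x : g_sigma_algebraType ray_cylinders => (x : nat -> R) n).
  by move=> /(_ measurableT _ mB); rewrite setTI.
apply: (measurability _ (RGenInftyO.measurableE R)).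
move=> _ [_ [r ->] <-]; rewrite setTI.
rewrite (_ : _ @^-1` _ =
    \bigcup_N ray_cylinder n.+1 (fun i => if i == n then r else N%:R)).
  apply: bigcupT_measurable => N; apply: sub_sigma_algebra.
  by exists n.+1, (fun i => if i == n then r else N%:R).
apply/seteqP; split => x /=; rewrite in_itv/=.
  move=> xr; pose N := (\max_(i < n) (Num.trunc `|(x : nat -> R) i|).+1)%N.
  exists N => // i; rewrite ltnS leq_eqVlt; case: eqP => [-> //|_ /= li].
  apply: le_lt_trans (ler_norm _) _.
  apply: lt_le_trans (Num.Theory.truncnS_gt _) _; rewrite ler_nat.
  exact: (@leq_bigmax _ (fun i : 'I_n => (Num.trunc `|(x : nat -> R) i|).+1)
    (Ordinal li)).
by move=> [N _ h]; have := h n (ltnSn n); rewrite eqxx.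
Qed.

Lemma Rinf_measure_unique (m1 m2 : {measure set (Rinf R) -> \bar R}) :
  (m1 setT < +oo)%E ->
  (forall n b, m1 (ray_cylinder n b) = m2 (ray_cylinder n b)) ->
  forall A, measurable A -> m1 A = m2 A.
Proof.
move=> fin eq12 A; rewrite measurable_Rinf_rays => mA.
have T0 : setT = ray_cylinder 0 (cst 0) by apply/seteqP; split.
apply: (@g_sigma_algebra_measure_unique _ R (Rinf R) ray_cylinders _ (fun=> setT))
  => //.
- by move=> _ [n [b ->]]; exact: measurable_ray_cylinder.
- by move=> _; exists 0%N, (cst 0).
- by rewrite bigcup_const.
- exact: setI_closed_ray_cylinders.
- by move=> _ [n [b ->]].
Qed.

End Rinf_rays.

(** * Gaussian transforms *)

Section gaussian_transform.
Context (R : realType).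

(** Completing the square: [exp x] times the centered density of variance [s^2]
    is [exp (s^2 / 2)] times the density with mean [s^2]. Rescaling [s] gives
    the whole transform. *)
Lemma centered_gaussian_transform (s : R)
    (m : {measure set (measurableTypeR R) -> \bar R}) :
  (forall B, measurable B -> m B = centered_gaussian s B) ->
  (\int[m]_x (expR x)%:E = (expR (s ^+ 2 / 2))%:E)%E.
Proof.
move=> mE.
have mexp : measurable_fun setT ((EFin \o @expR R) : measurableTypeR R -> \bar R).
  by apply: (measurableT_comp (@EFin_measurable R setT)); exact: measurable_expR.
have exp0 x : (0 <= (EFin \o @expR R) x)%E by rewrite lee_fin expR_ge0.
rewrite /centered_gaussian in mE; have [s0|s0] := eqVneq s 0.
  rewrite (@eq_measure_integral _ _ _ _ (dirac (0 : measurableTypeR R))); last first.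
    by move=> A mA _; rewrite mE// s0 eqxx.
  by rewrite integral_dirac// diracT mul1e s0 expR0 expr0n mul0r expR0.
pose pdf (x : measurableTypeR R) := (normal_pdf 0 s x)%:E.
have pdf0 x : (0 <= pdf x)%E by rewrite lee_fin normal_pdf_ge0.
have ipdf : lebesgue_measure.-integrable setT pdf by exact: integrable_normal_pdf.
rewrite (@eq_measure_integral _ _ _ _ (density pdf0 ipdf)); last first.
  by move=> A mA _; rewrite mE// (negbTE s0).
rewrite integral_density//.
have -> : (expR (s ^+ 2 / 2))%:E =
    (\int[lebesgue_measure]_x ((expR (s ^+ 2 / 2))%:E * (normal_pdf (s ^+ 2) s x)%:E))%E.
  rewrite integralZl//; last exact: integrable_normal_pdf.
  by rewrite integral_normal_pdf mule1.
apply: eq_integral => x _; rewrite /= -!EFinM; congr EFin.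
rewrite !normal_pdfE// -[LHS]/(expR x * (normal_peak s * normal_fun 0 s x)).
rewrite -[RHS]/(expR (s ^+ 2 / 2) *
  (normal_peak s * normal_fun (s ^+ 2) s x)).
rewrite /normal_fun !(mulrCA _ (normal_peak s)); congr (_ * _).
rewrite -!expRD; congr expR.
by field.
Qed.

End gaussian_transform.

Section gaussian_field.
Context (R : realType) (H : completeNormedModType R).

(** Linearity holds only almost everywhere, with an exceptional set depending on
    the vectors, hence the statement for one finite combination at a time. *)
Lemma generalized_function_sum d (T : measurableType d)
    (mu : {finite_measure set T -> \bar R}) (Y : H -> {mfun_ mu, T >-> R})
    (e : nat -> H) (a : nat -> R) n : generalized_function Y ->
  {ae mu, forall t, Y (\sum_(i < n) a i *: e i) t = \sum_(i < n) a i * Y (e i) t}.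
Proof.
move=> [lin _]; elim: n => [|n ih].
  have := lin 1 0 0; apply: filterS => t.
  by rewrite scale1r addr0 mul1r !big_ord0 => h; lra.
have := lin (a n) (e n) (\sum_(i < n) a i *: e i); apply: filterS2 ih => t.
by rewrite !big_ord_recr/= addrC => -> ->; rewrite addrC.
Qed.

Context d (Omega : measurableType d) (P : probability Omega R)
  (X : H -> {mfun_ P, Omega >-> R}).

Lemma gaussian_transform : standard_gaussian X -> forall u,
  (\int[P]_w (expR (X u w))%:E = (expR (`|u| ^+ 2 / 2))%:E)%E.
Proof.
move=> [_ gX] u.
have mX : measurable_fun setT (X u : Omega -> measurableTypeR R).
  exact: (measurable_funPT (repr (X u))).
have := @ge0_integral_pushforward _ _ _ _ _ _ mX P setT (EFin \o @expR R).
rewrite preimage_setT => <- //.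
- exact: (@centered_gaussian_transform R `|u|
    (pushforward P (X u : Omega -> measurableTypeR R)) (gX u)).
- by apply: (measurableT_comp (@EFin_measurable R setT)); exact: measurable_expR.
- by move=> y _; rewrite lee_fin expR_ge0.
Qed.

End gaussian_field.

(** * Laws of weighted random sequences *)

Section mean_measure.
Context (R : realType) d1 (Omega : measurableType d1) (P : probability Omega R)
  d2 (T : measurableType d2) (mu : {measure set T -> \bar R})
  (M : R.-ker Omega ~> T).
Local Open Scope ereal_scope.
Import HBNNSimple.

(** Simple functions, then monotone convergence on both sides. *)
Lemma integral_mean_measure (f : T -> \bar R) :
  (forall A, measurable A -> mean_measure P M A = mu A) ->
  measurable_fun setT f -> (forall t, 0 <= f t) ->
  \int[P]_w \int[M w]_t f t = \int[mu]_t f t.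
Proof.
move=> meanM mf f0.
have sint (h : {nnsfun T >-> R}) : sintegral mu h = \int[P]_w sintegral (M w) h.
  under eq_integral do rewrite sintegralE.
  rewrite ge0_integral_fsum//; last 2 first.
    by move=> r; apply: measurable_funeM; exact: measurable_kernel.
    by move=> r w _; exact: nnsfun_mulemu_ge0.
  rewrite sintegralE; apply: eq_fsbigr => r; rewrite inE => -[t _ <-].
  by rewrite -meanM// ge0_integralZl ?lee_fin//; exact: measurable_kernel.
pose g := nnsfun_approx measurableT mf.
pose gE := fun n => EFin \o g n.
have mgE n : measurable_fun [set: T] (gE n) by exact/measurable_EFinP.
have gE_ge0 n x : 0 <= gE n x by rewrite lee_fin.
have nd_gE x : {homo gE ^~ x : n m / (n <= m)%O >-> n <= m}.
  by move=> *; exact/lefP/nd_nnsfun_approx.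
have limE (m : {measure set T -> \bar R}) :
    \int[m]_t f t = limn (fun n => \int[m]_t gE n t).
  rewrite -monotone_convergence//; apply: eq_integral => t _.
  by apply/esym/cvg_lim => //; exact: cvg_nnsfun_approx.
rewrite limE; under eq_integral do rewrite limE.
rewrite monotone_convergence//.
- apply: congr_lim; apply/funext => n.
  rewrite integralT_nnsfun sint; apply: eq_integral => w _.
  by rewrite integralT_nnsfun.
- move=> n; apply: measurable_fun_integral_kernel => // U mU.
  exact: measurable_kernel.
- by move=> n w _; exact: integral_ge0.
- by move=> w _ m n mn; apply: ge0_le_integral => // t _; exact: nd_gE.
Qed.

End mean_measure.

Section joint_law.
Context (R : realType)
  d1 (S1 : measurableType d1) (rho1 : {sigma_finite_measure set S1 -> \bar R})
  d2 (S2 : measurableType d2) (rho2 : {sigma_finite_measure set S2 -> \bar R})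
  (F1 : {mfun S1 >-> Rinf R}) (F2 : {mfun S2 >-> Rinf R}) (w1 : S1 -> R) (w2 : S2 -> R).
Context (mw1 : measurable_fun setT w1) (mw2 : measurable_fun setT w2)
  (w1_ge0 : forall x, 0 <= w1 x) (w2_ge0 : forall x, 0 <= w2 x).

Lemma indic_ray_cylinder n (b : nat -> R) (x : Rinf R) :
  \1_(ray_cylinder n b) x = \prod_(i < n) ((x : nat -> R) i < b i)%R%:R :> R.
Proof.
rewrite indicE; case: (boolP (x \in _)) => [|].
  rewrite inE => h; rewrite big1// => i _; by rewrite h.
rewrite notin_setE => h; apply/esym/eqP.
have : exists i : 'I_n, ~~ ((x : nat -> R) i < b i).
  apply/existsP; rewrite -negb_forall; apply/negP => /forallP k; apply: h => i li.
  exact: (k (Ordinal li)).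
by move=> [i /negbTE xi]; rewrite (bigD1 i)//= xi mul0r.
Qed.

(** The cylinders are a pi-system generating the sigma-algebra, so equality on
    them extends to the images of the two weighted measures, and thence to
    integrals. *)
Lemma joint_law_integral :
  (\int[rho1]_x (w1 x)%:E < +oo)%E ->
  (forall n (b : nat -> R),
    (\int[rho1]_x (w1 x * \prod_(i < n) ((F1 x : nat -> R) i < b i)%R%:R)%:E =
     \int[rho2]_x (w2 x * \prod_(i < n) ((F2 x : nat -> R) i < b i)%R%:R)%:E)%E) ->
  forall G : Rinf R -> \bar R, measurable_fun setT G -> (forall x, 0 <= G x)%E ->
    (\int[rho1]_x (G (F1 x) * (w1 x)%:E) = \int[rho2]_x (G (F2 x) * (w2 x)%:E))%E.
Proof.
move=> fin1 eq12 G mG G0.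
have fin2 : (\int[rho2]_x (w2 x)%:E < +oo)%E.
  have := eq12 0%N (cst 0).
  under eq_integral do rewrite big_ord0 mulr1.
  by under [X in _ = X -> _]eq_integral do rewrite big_ord0 mulr1; move=> <-.
have w1E x : (0 <= (EFin \o w1) x)%E by rewrite lee_fin.
have w2E x : (0 <= (EFin \o w2) x)%E by rewrite lee_fin.
have iw1 : rho1.-integrable setT (EFin \o w1).
  apply/integrableP; split; first exact/measurable_EFinP.
  by under eq_integral do rewrite gee0_abs//.
have iw2 : rho2.-integrable setT (EFin \o w2).
  apply/integrableP; split; first exact/measurable_EFinP.
  by under eq_integral do rewrite gee0_abs//.
have dE d (S : measurableType d) (rho : {sigma_finite_measure set S -> \bar R})
    (F : {mfun S >-> Rinf R}) (w : S -> R) (w0 : forall x, (0 <= (EFin \o w) x)%E)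
    (iw : rho.-integrable setT (EFin \o w)) n b :
    (pushforward (density w0 iw) F (ray_cylinder n b) =
    \int[rho]_x (w x * \prod_(i < n) ((F x : nat -> R) i < b i)%R%:R)%:E)%E.
  rewrite /pushforward /density integral_mkcond.
  apply: eq_integral => x _; rewrite epatch_indic/= -indic_ray_cylinder EFinM.
  by rewrite !indicE; congr (_ * _%:R%:E)%E; congr nat_of_bool;
     apply/idP/idP; rewrite !inE.
have fin : (pushforward (density w1E iw1) F1 setT < +oo)%E.
  by rewrite /pushforward preimage_setT /density.
have h : forall A, measurable A ->
    pushforward (density w1E iw1) F1 A = pushforward (density w2E iw2) F2 A.
  by apply: (Rinf_measure_unique fin) => n b;
     exact: (etrans (dE _ _ _ _ _ _ _ n b)
       (etrans (eq12 n b) (esym (dE _ _ _ _ _ _ _ n b)))).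
have pE d (S : measurableType d) (rho : {sigma_finite_measure set S -> \bar R})
    (F : {mfun S >-> Rinf R}) (w : S -> R) (w0 : forall x, (0 <= (EFin \o w) x)%E)
    (iw : rho.-integrable setT (EFin \o w)) :
    (\int[rho]_x (G (F x) * (w x)%:E) = \int[pushforward (density w0 iw) F]_y G y)%E.
  rewrite ge0_integral_pushforward// preimage_setT.
  rewrite integral_density//; last by move=> x; exact: G0.
  exact: (measurableT_comp mG (measurable_funPT F)).
rewrite (pE _ _ _ _ _ w1E iw1)// (pE _ _ _ _ _ w2E iw2)//.
by apply: eq_measure_integral => A mA _; exact: h.
Qed.

End joint_law.

(** * The Cameron-Martin formula *)

Section cameron_martin.
Context (R : realType) (H : completeNormedModType R) (ip : {dot H for idfun})
  (e : nat -> H) d1 (Omega : measurableType d1) (P : probability Omega R)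
  (X : H -> {mfun_ P, Omega >-> R}).
Context (normE : forall u : H, `|u| ^+ 2 = ip u u) (gX : standard_gaussian X).

Let dotC u v : ip u v = ip v u.
Proof. by rewrite hermC /= expr0 mul1r. Qed.

Let normD2 u v : `|u + v| ^+ 2 = `|u| ^+ 2 + `|v| ^+ 2 + 2 * ip u v.
Proof. by rewrite !normE hnormD /= expr0 mul1r; lra. Qed.

Let mX u : measurable_fun setT (X u).
Proof. exact: (measurable_funPT (repr (X u))). Qed.

Let lin_comb (a : nat -> R) n : H := \sum_(i < n) a i *: e i.

Lemma gaussian_affine_transform (u : H) (c : R) (g : Omega -> R) :
  measurable_fun setT g -> {ae P, forall w, g w = X u w + c} ->
  (\int[P]_w (expR (g w))%:E = (expR (`|u| ^+ 2 / 2 + c))%:E)%E.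
Proof.
move=> mg gE.
rewrite expRD EFinM -(gaussian_transform gX u) -ge0_integralZr//=; last first.
  by apply/measurable_EFinP; exact: measurableT_comp.
apply: ae_eq_integral => //.
- by apply/measurable_EFinP; exact: measurableT_comp.
- apply: emeasurable_funM => //.
  by apply/measurable_EFinP; exact: measurableT_comp.
- by apply: filterS gE => w /= -> _; rewrite expRD EFinM.
Qed.

Lemma measurable_shift_value xi :
  measurable_fun setT (fun w => Defs.shift ip e (value e X w) xi).
Proof.
apply: measurable_Rinf => n; apply: measurable_funD => //.
Qed.

(** With [u] the combination of the [e i] with coefficients [a], both sides have
    the transform [exp (|u|^2 / 2 + <xi, u>)] at [a]. *)
Lemma cameron_martin (xi : H) (G : Rinf R -> \bar R) :
  measurable_fun setT G -> (forall x, 0 <= G x)%E ->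
  (\int[P]_w G (Defs.shift ip e (value e X w) xi) =
   \int[P]_w (G (value e X w) * (expR (X xi w - `|xi| ^+ 2 / 2))%:E))%E.
Proof.
move=> mG G0.
pose F1 : {mfun Omega >-> Rinf R} := mfun_Sub (mem_set (measurable_shift_value xi)).
pose F2 : {mfun Omega >-> Rinf R} := value e X.
have mw2 : measurable_fun setT (fun w => expR (X xi w - `|xi| ^+ 2 / 2)).
  by apply: measurableT_comp => //; apply: measurable_funB => //; exact: mX.
have F1E w i : (F1 w : nat -> R) i = X (e i) w + ip xi (e i) by [].
have mF1 i : measurable_fun setT (fun w => (F1 w : nat -> R) i).
  under eq_fun do rewrite F1E; apply: measurable_funD => //; exact: mX.
have mF2 i : measurable_fun setT (fun w => (F2 w : nat -> R) i) by exact: mX.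
have E1 n (a : nat -> R) :
    (\int[P]_w (1 * expR (\sum_(i < n) a i * (F1 w : nat -> R) i))%:E =
     (expR (`|lin_comb a n| ^+ 2 / 2 + ip xi (lin_comb a n)))%:E)%E.
  under eq_integral do rewrite mul1r.
  apply: gaussian_affine_transform.
    by apply: measurable_sum => i; apply: measurable_funM => //; exact: mF1.
  have := generalized_function_sum e a n gX.1; apply: filterS => w ->.
  rewrite /lin_comb linear_sumr/= -big_split/=; apply: eq_bigr => i _.
  by rewrite linearZr_LR /= -mulrDr.
have E2 n (a : nat -> R) :
    (\int[P]_w (expR (X xi w - `|xi| ^+ 2 / 2) *
      expR (\sum_(i < n) a i * (F2 w : nat -> R) i))%:E =
     (expR (`|lin_comb a n| ^+ 2 / 2 + ip xi (lin_comb a n)))%:E)%E.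
  under eq_integral do rewrite -expRD.
  rewrite (@gaussian_affine_transform (lin_comb a n + xi) (- (`|xi| ^+ 2 / 2))).
  - by congr (expR _)%:E; rewrite normD2 (dotC xi); lra.
  - apply: measurable_funD; first by apply: measurable_funB => //; exact: mX.
    by apply: measurable_sum => i; apply: measurable_funM => //; exact: mF2.
  - have := gX.1.1 1 (lin_comb a n) xi.
    have := generalized_function_sum e a n gX.1; apply: filterS2 => w.
    by rewrite scale1r mul1r => <- ->; lra.
under eq_integral do rewrite -[G _]mule1.
apply: (@joint_law_integral _ _ _ P _ _ P F1 F2 (cst 1)
  (fun w => expR (X xi w - `|xi| ^+ 2 / 2))) => //.
- rewrite (_ : (\int[P]_x _)%E = (\int[P]_(x in setT) (cst 1%E x))%E)//.
  by rewrite integral_cst//= mul1e (le_lt_trans (probability_le1 P measurableT))// ltry.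
- move=> n b.
  apply: (@joint_ray_unique _ _ _ P _ _ P (fun i w => (F1 w : nat -> R) i)
    (fun i w => (F2 w : nat -> R) i)) => //.
  + by move=> a; rewrite E1 ltry.
  + by move=> a; rewrite E1 E2.
Qed.

End cameron_martin.

(** * The law of the field under the rooted measure *)

Section finite_product.
Context (R : realType) d1 (Omega : measurableType d1) (P : probability Omega R)
  d2 (T : measurableType d2) (mu : {finite_measure set T -> \bar R}).

(** The product under a name that carries the structure of a finite measure. *)
Definition finite_product : set (Omega * T) -> \bar R := (P \x mu)%E.

HB.instance Definition _ := Measure.on finite_product.

Let finite_product_fin_num : fin_num_fun finite_product.
Proof.
move=> A mA; rewrite ge0_fin_numE//.
apply: (@le_lt_trans _ _ (finite_product setT)); first by rewrite le_measure ?inE.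
rewrite /finite_product -setXTT product_measure1E//.
by rewrite lte_mul_pinfty// ?fin_num_measure// -ge0_fin_numE// fin_num_measure.
Qed.

HB.instance Definition _ :=
  Measure_isFinite.Build _ _ _ finite_product finite_product_fin_num.

End finite_product.
Section gmc_law.
Context (R : realType) (H : completeNormedModType R) (ip : {dot H for idfun})
  (e : nat -> H) d1 (Omega : measurableType d1) (P : probability Omega R)
  d2 (T : measurableType d2) (mu : {finite_measure set T -> \bar R})
  (X : H -> {mfun_ P, Omega >-> R}) (Y : H -> {mfun_ mu, T >-> R})
  (M : R.-ker Omega ~> T).
Context (normE : forall u : H, `|u| ^+ 2 = ip u u) (gX : standard_gaussian X)
  (gY : generalized_function Y) (gmcM : gmc ip e X Y M)
  (meanM : forall A, measurable A -> mean_measure P M A = mu A).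

Let mX u : measurable_fun setT (X u).
Proof. exact: (measurable_funPT (repr (X u))). Qed.

Let mY u : measurable_fun setT (Y u).
Proof. exact: (measurable_funPT (repr (Y u))). Qed.

Let mM A : measurable A -> measurable_fun setT (M ^~ A).
Proof. by move=> mA; exact: measurable_kernel. Qed.

(** Cameron-Martin turns the exponential of [X xi] into a shift of [X] by [xi],
    and the shift equation turns that into the exponential of [Y xi] under [M],
    whose expectation is an integral against [mu]. *)
Lemma gmc_transform (xi : H) (A : set T) : measurable A ->
  (\int[P]_w (M w A * (expR (X xi w))%:E) =
   (expR (`|xi| ^+ 2 / 2))%:E * \int[mu]_(t in A) (expR (Y xi t))%:E)%E.
Proof.
move=> mA; have [_ [m mE shiftE]] := gmcM.
have mexpX : measurable_fun setT (fun w => (expR (X xi w))%:E).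
  by apply/measurable_EFinP; exact: measurableT_comp.
have mm : measurable_fun setT (m ^~ A) by exact: measurable_kernel.
have mexp : measurable_fun setT ((fun t => (expR (Y xi t))%:E) \_ A).
  apply/(measurable_restrictT _ mA)/measurable_funTS/measurable_EFinP.
  exact: measurableT_comp.
have exp0 t : (0 <= ((fun t => (expR (Y xi t))%:E) \_ A) t)%E.
  by apply: erestrict_ge0 => s _; rewrite lee_fin expR_ge0.
have CM := @cameron_martin _ _ _ e _ _ _ X normE gX xi (m ^~ A) mm
  (fun x => measure_ge0 _ _).
have L : (\int[P]_w (m (Defs.shift ip e (value e X w) xi) A) =
    \int[mu]_(t in A) (expR (Y xi t))%:E)%E.
  rewrite [RHS]integral_mkcond -(integral_mean_measure meanM)//.
  apply: ae_eq_integral => //.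
  - exact: (measurableT_comp mm (measurable_shift_value _ _ _ _)).
  - apply: measurable_fun_integral_kernel => //.
  - have := shiftE xi; apply: filterS2 mE => w /= wE /(_ _ mA) -> _.
    rewrite integral_mkcond; apply: eq_measure_integral => B mB _.
    by rewrite wE.
have Rr : (\int[P]_w (m (value e X w) A * (expR (X xi w - `|xi| ^+ 2 / 2))%:E) =
    \int[P]_w (M w A * (expR (X xi w))%:E) * (expR (- (`|xi| ^+ 2 / 2)))%:E)%E.
  rewrite -ge0_integralZr ?lee_fin ?expR_ge0//; last first.
    exact: emeasurable_funM (mM mA) mexpX.
  apply: ae_eq_integral => //.
  - apply: emeasurable_funM; first exact: (measurableT_comp mm (measurable_value _ _)).
    apply/measurable_EFinP; apply: measurableT_comp => //.
    by apply: measurable_funB => //; exact: mX.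
  - by apply: emeasurable_funM => //; exact: emeasurable_funM (mM mA) mexpX.
  - by apply: filterS mE => w /= wE _; rewrite wE// expRD EFinM muleA.
rewrite -L CM Rr muleCA -EFinM -expRD subrr expR0 mule1//.
Qed.

Lemma ae_kernel_fin : {ae P, forall w, forall A, measurable A -> M w A \is a fin_num}.
Proof.
have [[fin _] _] := gmcM; apply: filterS fin => w wfin A mA.
by rewrite ge0_fin_numE//; apply: le_lt_trans wfin; rewrite le_measure ?inE.
Qed.

(** [M w A] can be infinite on a null set, whereas the weights of the uniqueness
    theorem are real: [fine] makes the passage. *)
Lemma integral_fine_kernel (A : set T) (h : Omega -> R) : measurable A ->
  measurable_fun setT h ->
  (\int[P]_w (fine (M w A) * h w)%:E = \int[P]_w (M w A * (h w)%:E))%E.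
Proof.
move=> mA mh; apply: ae_eq_integral => //.
- apply/measurable_EFinP; apply: measurable_funM => //.
  by apply: measurableT_comp => //; exact: mM.
- by apply: emeasurable_funM; [exact: mM|exact/measurable_EFinP].
- by apply: filterS ae_kernel_fin => w /= wfin _; rewrite EFinM fineK// wfin.
Qed.

Lemma integral_kernelT : (\int[P]_w M w setT < +oo)%E.
Proof.
rewrite -[X in (X < _)%E]/(mean_measure P M setT) meanM//.
by rewrite ltey_eq fin_num_measure.
Qed.

Lemma integral_fine_kernel_lty (A : set T) : measurable A ->
  (\int[P]_w (fine (M w A))%:E < +oo)%E.
Proof.
move=> mA.
have := @integral_fine_kernel A (cst 1) mA (measurable_cst _).
under eq_integral do rewrite mulr1.
under [X in _ = X -> _]eq_integral do rewrite mule1.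
move=> ->; apply: le_lt_trans integral_kernelT.
apply: ge0_le_integral => //; [exact: mM|exact: mM|].
by move=> w _; rewrite le_measure ?inE.
Qed.


Let lin_comb (a : nat -> R) n : H := \sum_(i < n) a i *: e i.

Let mexpY (a : nat -> R) n :
  measurable_fun setT (fun t => expR (\sum_(i < n) a i * Y (e i) t)).
Proof.
apply: measurableT_comp => //; apply: measurable_sum => i.
by apply: measurable_funM => //; exact: mY.
Qed.

Let mexpX (a : nat -> R) n :
  measurable_fun setT (fun w => expR (\sum_(i < n) a i * X (e i) w)).
Proof.
apply: measurableT_comp => //; apply: measurable_sum => i.
by apply: measurable_funM => //; exact: mX.
Qed.

(** This and [product_transform] compute the transforms of the two weighted laws
    that the main identity compares. *)
Lemma kernel_transform (a : nat -> R) n (A : set T) : measurable A ->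
  (\int[P]_w (fine (M w A) * expR (\sum_(i < n) a i * X (e i) w))%:E =
   (expR (`|lin_comb a n| ^+ 2 / 2))%:E *
     \int[mu]_(t in A) (expR (\sum_(i < n) a i * Y (e i) t))%:E)%E.
Proof.
move=> mA; rewrite integral_fine_kernel//.
transitivity (\int[P]_w (M w A * (expR (X (lin_comb a n) w))%:E))%E.
  apply: ae_eq_integral => //.
  - by apply: emeasurable_funM; [exact: mM|exact/measurable_EFinP].
  - apply: emeasurable_funM; first exact: mM.
    by apply/measurable_EFinP; exact: measurableT_comp.
  - by have := generalized_function_sum e a n gX.1; apply: filterS => w /= -> _.
rewrite gmc_transform//; congr (_ * _)%E; apply: ae_eq_integral => //.
- by apply/measurable_funTS/measurable_EFinP; exact: measurableT_comp.
- by apply/measurable_funTS/measurable_EFinP; exact: mexpY.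
- by have := generalized_function_sum e a n gY; apply: filterS => t /= -> _.
Qed.

Lemma product_transform (a : nat -> R) n (A : set T) : measurable A ->
  (\int[P \x mu]_p (\1_A p.2 *
     expR (\sum_(i < n) a i * (value_sum e X Y p : nat -> R) i))%:E =
   (expR (`|lin_comb a n| ^+ 2 / 2))%:E *
     \int[mu]_(t in A) (expR (\sum_(i < n) a i * Y (e i) t))%:E)%E.
Proof.
move=> mA; rewrite fubini_tonelli2; last 2 first.
- apply/measurable_EFinP; apply: measurable_funM.
    exact: measurableT_comp (measurable_indic mA) measurable_snd.
  apply: measurableT_comp => //; apply: measurable_sum => i.
  apply: measurable_funM => //.
  exact: measurableT_comp (measurable_coord i) (measurable_value_sum _ _ _).
- by move=> p; rewrite lee_fin mulr_ge0 ?expR_ge0.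
rewrite -ge0_integralZl ?lee_fin ?expR_ge0//; last first.
  by apply/measurable_funTS/measurable_EFinP; exact: mexpY.
rewrite [RHS]integral_mkcond.
apply: eq_integral => t _; rewrite epatch_indic/= /fubini_G/=.
under eq_integral => w _.
  rewrite (_ : _ * _ = expR (\sum_(i < n) a i * X (e i) w) *
      (expR (\sum_(i < n) a i * Y (e i) t) * \1_A t)); last first.
    rewrite mulrA -expRD -big_split/= mulrC; congr (expR _ * _).
    by apply: eq_bigr => i _; rewrite /value_sum/= mulrDr.
  rewrite EFinM; over.
rewrite ge0_integralZr ?lee_fin ?mulr_ge0 ?expR_ge0//; last first.
  by apply/measurable_EFinP; exact: mexpX.
rewrite EFinM muleA; congr (_ * _ * _)%E.
rewrite (@gaussian_affine_transform _ _ _ _ _ _ gX (lin_comb a n) 0) ?addr0//.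
  by apply: measurable_sum => i; apply: measurable_funM => //; exact: mX.
have := generalized_function_sum e a n gX.1.
by apply: filterS => w; rewrite addr0 => <-.
Qed.

(** The bound on [Y] makes the transforms finite. *)
Lemma truncated_law n (b : nat -> R) (A : set T) (N : R) : measurable A ->
  (forall t i, A t -> (i < n)%N -> `|Y (e i) t| <= N) ->
  (\int[P]_w (fine (M w A) *
     \prod_(i < n) ((value e X w : nat -> R) i < b i)%R%:R)%:E =
   \int[P \x mu]_p (\1_A p.2 *
     \prod_(i < n) ((value_sum e X Y p : nat -> R) i < b i)%R%:R)%:E)%E.
Proof.
move=> mA AN.
apply: (@joint_ray_unique _ _ _ P _ _ (P \x mu)%E
  (fun i w => (value e X w : nat -> R) i)
  (fun i p => (value_sum e X Y p : nat -> R) i)).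
- by move=> i; exact: mX.
- by move=> i; exact: measurableT_comp (measurable_coord i) (measurable_value_sum _ _ _).
- by apply: measurableT_comp => //; exact: mM.
- exact: measurableT_comp (measurable_indic mA) measurable_snd.
- by move=> w; rewrite fine_ge0.
- by move=> p.
- move=> a; rewrite kernel_transform//.
  rewrite lte_mul_pinfty ?lee_fin ?expR_ge0//.
  apply: (@le_lt_trans _ _
    (\int[mu]_(t in A) (cst (expR (\sum_(i < n) `|a i| * N))%:E) t)%E).
    apply: ge0_le_integral => //.
    + by apply/measurable_funTS/measurable_EFinP; exact: mexpY.
    + move=> t At; rewrite lee_fin ler_expR; apply: ler_sum => i _.
      apply: (le_trans (ler_norm _)); rewrite normrM ler_wpM2l//.
      exact: AN.
  by rewrite integral_cst// lte_mul_pinfty ?lee_fin ?expR_ge0// ltey_eq fin_num_measure.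
- by move=> a; rewrite kernel_transform// product_transform.
Qed.

Let mray n (b : nat -> R) d (U : measurableType d) (F : U -> Rinf R) :
  measurable_fun setT F -> measurable_fun setT
    (fun x => \prod_(i < n) ((F x : nat -> R) i < b i)%R%:R : R).
Proof.
move=> mF; under eq_fun do rewrite -indic_ray_cylinder.
exact: measurableT_comp (measurable_indic (measurable_ray_cylinder n b)) mF.
Qed.

(** [A] is the increasing union of its parts [A_ N] on which the first [n]
    coordinates of [Y] are bounded by [N]. This truncation depends on [n], so it
    has to be removed before passing from cylinders to arbitrary sets. *)
Lemma ray_law n (b : nat -> R) (A : set T) : measurable A ->
  (\int[P]_w (fine (M w A) *
     \prod_(i < n) ((value e X w : nat -> R) i < b i)%R%:R)%:E =
   \int[P \x mu]_p (\1_A p.2 *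
     \prod_(i < n) ((value_sum e X Y p : nat -> R) i < b i)%R%:R)%:E)%E.
Proof.
move=> mA.
pose K N := [set t | forall i, (i < n)%N -> `|Y (e i) t| <= N%:R].
pose A_ N := A `&` K N.
have mK N : measurable (K N).
  rewrite (_ : K N = \bigcap_(i < n) [set t | `|Y (e i) t| <= N%:R])//.
  rewrite bigcap_mkord; apply: bigsetI_measurable => i _.
  have mn : measurable_fun setT (fun t => `|Y (e i) t|) by exact: measurableT_comp.
  have := mn measurableT `]-oo, N%:R]%classic (measurable_itv _).
  by rewrite setTI; congr measurable; apply/seteqP; split => t /=; rewrite in_itv.
have mA_ N : measurable (A_ N) by exact: measurableI.
have A_nd : {homo A_ : N N' / (N <= N')%N >-> N `<=` N'}.
  move=> N N' NN' t [At Kt]; split => // i li.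
  by apply: (le_trans (Kt i li)); rewrite ler_nat.
have A_E : \bigcup_N A_ N = A.
  apply/seteqP; split => [t [N _ []//]|t At].
  pose N := (\max_(i < n) (Num.trunc `|Y (e i) t|).+1)%N.
  exists N => //; split => // i li; apply/ltW.
  apply: lt_le_trans (Num.Theory.truncnS_gt _) _; rewrite ler_nat.
  exact: (@leq_bigmax _ (fun i : 'I_n => (Num.trunc `|Y (e i) t|).+1) (Ordinal li)).
have mpX := @mray n b _ _ _ (measurable_value e X).
have mpXY := @mray n b _ _ _ (measurable_value_sum e X Y).
have p0 (x : nat -> R) : 0 <= \prod_(i < n) (x i < b i)%R%:R :> R.
  by rewrite prodr_ge0.
have trunc N := @truncated_law n b (A_ N) N%:R (mA_ N) (fun t i At li => At.2 i li).
rewrite integral_fine_kernel//.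
have L : (\int[P]_w (M w A * (\prod_(i < n) ((value e X w : nat -> R) i < b i)%R%:R)%:E)
  = limn (fun N => \int[P]_w (M w (A_ N) *
      (\prod_(i < n) ((value e X w : nat -> R) i < b i)%R%:R)%:E)))%E.
  rewrite -monotone_convergence//.
  - apply: eq_integral => w _; apply/esym/cvg_lim => //.
    apply: cvgeZr => //; rewrite -[X in M w X]A_E.
    apply: nondecreasing_cvg_mu => //; first by rewrite A_E.
    by move=> N N' NN'; apply/subsetPset; exact: A_nd.
  - by move=> N; apply: emeasurable_funM; [exact: mM|exact/measurable_EFinP].
  - by move=> N w _; rewrite mule_ge0// lee_fin.
  - move=> w _ N N' NN'; rewrite lee_wpmul2r ?lee_fin//.
    by rewrite le_measure ?inE//; exact: A_nd.
rewrite {}L.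
have L : (\int[P \x mu]_p (\1_A p.2 *
     \prod_(i < n) ((value_sum e X Y p : nat -> R) i < b i)%R%:R)%:E
  = limn (fun N => \int[P \x mu]_p (\1_(A_ N) p.2 *
     \prod_(i < n) ((value_sum e X Y p : nat -> R) i < b i)%R%:R)%:E))%E.
  rewrite -monotone_convergence//.
  - apply: eq_integral => p _; apply/esym/cvg_lim => //.
    apply: cvg_EFin; first exact: nearW.
    apply: cvgMl; have [Ap|nAp] := pselect (A p.2).
      have : (\bigcup_N A_ N) p.2 by rewrite A_E.
      move=> [N0 _ AN0]; apply: cvg_near_cst; near=> N.
      rewrite !indicE !mem_set//; apply: (A_nd N0 N) => //.
      by near: N; exact: nbhs_infty_ge.
    apply: cvg_near_cst; apply: nearW => N.
    by rewrite !indicE !memNset// => -[].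
  - move=> N; apply/measurable_EFinP; apply: measurable_funM => //.
    exact: measurableT_comp (measurable_indic (mA_ N)) measurable_snd.
  - by move=> N p _; rewrite lee_fin mulr_ge0.
  - move=> p _ N N' NN'; rewrite lee_fin ler_wpM2r// !indicE ler_nat.
    case: (boolP (_ \in A_ N)) => //; rewrite inE => /(A_nd _ _ NN') h.
    by rewrite mem_set.
rewrite {}L; apply: congr_lim; apply/funext => N.
by rewrite -trunc integral_fine_kernel.
Unshelve. all: by end_near. Qed.

Lemma gmc_law_integral (A : set T) (G : Rinf R -> \bar R) : measurable A ->
  measurable_fun setT G -> (forall x, 0 <= G x)%E ->
  (\int[P]_w (G (value e X w) * M w A) =
   \int[P \x mu]_p (G (value_sum e X Y p) * (\1_A p.2)%:E))%E.
Proof.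
move=> mA mG G0.
transitivity (\int[P]_w (G (value e X w) * (fine (M w A))%:E))%E.
  apply: ae_eq_integral => //.
  - apply: emeasurable_funM; last exact: mM.
    exact: (measurableT_comp mG (measurable_value _ _)).
  - apply: emeasurable_funM.
      exact: (measurableT_comp mG (measurable_value _ _)).
    by apply/measurable_EFinP; apply: measurableT_comp => //; exact: mM.
  - by apply: filterS ae_kernel_fin => w wfin _; rewrite fineK// wfin.
pose F1 : {mfun Omega >-> Rinf R} := value e X.
pose F2 : {mfun (Omega * T)%type >-> Rinf R} := value_sum e X Y.
have := @joint_law_integral _ _ _ P _ _ (finite_product P mu) F1 F2
  (fun w => fine (M w A)) (fun p => \1_A p.2).
apply => //.
- by apply: measurableT_comp => //; exact: mM.
- exact: measurableT_comp (measurable_indic mA) measurable_snd.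
- exact: integral_fine_kernel_lty.
- by move=> n b; exact: ray_law.
Qed.

(** The main identity: its right-hand side does not mention [M]. *)
Lemma gmc_law_set (A : set T) (D : set (Rinf R)) : measurable A -> measurable D ->
  (\int[P]_w (M w A * (\1_D (value e X w))%:E) =
   (P \x mu) (snd @^-1` A `&` value_sum e X Y @^-1` D))%E.
Proof.
move=> mA mD.
under eq_integral do rewrite muleC.
have mD1 : measurable_fun setT (EFin \o \1_D : Rinf R -> \bar R).
  by apply/measurable_EFinP; exact: measurable_indic.
have D10 x : (0 <= (EFin \o \1_D : Rinf R -> \bar R) x)%E by rewrite lee_fin.
rewrite (gmc_law_integral mA mD1 D10).
have mAD : measurable (snd @^-1` A `&` value_sum e X Y @^-1` D).
  apply: measurableI; rewrite -[X in measurable X]setTI.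
    exact: measurable_snd.
  exact: measurable_value_sum.
rewrite -[X in (P \x mu)%E X]setIT -(integral_indic _ _ mAD)//.
apply: eq_integral => p _; rewrite /= -EFinM indicI mulrC; congr (_ * _)%:E.
Qed.

End gmc_law.

(** * Kernels determined almost everywhere by their integrals *)

Section determined_kernels.
Context (R : realType) d (T : measurableType d).

(** Through an injection of the space into the line, the preimages of the
    half-lines with rational end points form a countable pi-system, and they
    generate because images of measurable sets are Borel. *)
Lemma standard_countable_determining : standard_measurable_space R T ->
  exists2 r : nat -> set T, (forall n, measurable (r n)) &
    forall m1 m2 : {measure set T -> \bar R}, (m1 setT < +oo)%E ->
      (forall n, m1 (r n) = m2 (r n)) -> forall A, measurable A -> m1 A = m2 A.
Proof.
move=> [f [mf injf imf]].
pose q n : rat := odflt 0 (unpickle n).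
have qE p : exists n, q n = p by exists (pickle p); rewrite /q pickleK.
pose r n := f @^-1` `]-oo, (ratr (q n) : R)[%classic.
have mr n : measurable (r n).
  by rewrite -[r n]setTI; apply: mf => //; exact: measurable_itv.
pose G := [set A | exists n, A = r n].
have mG : measurable `<=` <<s G >>.
  move=> A mA; have -> : A = f @^-1` (f @` A).
    apply/seteqP; split => [t At|t [s As /injf <-]//]; by exists t.
  suff : measurable_fun setT (f : g_sigma_algebraType G -> R).
    by move=> /(_ measurableT _ (imf A mA)); rewrite setTI.
  apply: (measurability _ (RGenInftyO.measurableE R)).
  move=> _ [_ [x ->] <-]; rewrite setTI.
  rewrite (_ : _ @^-1` _ =
    \bigcup_p (if ratr p <= x then f @^-1` `]-oo, (ratr p : R)[%classic else set0)).
    apply: bigcupT_measurable_rat => p; case: ifP => // _.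
    by have [n <-] := qE p; apply: sub_sigma_algebra; exists n.
  apply/seteqP; split => t /=; rewrite in_itv/=.
    move=> /rat_in_itvoo[p]; rewrite in_itv/= => /andP[ftp px].
    by exists p => //; rewrite (ltW px)/= in_itv.
  move=> [p _]; case: ifP => // px; rewrite /= in_itv/= => ftp.
  exact: lt_le_trans px.
exists r => // m1 m2 fin eq12 A /mG mA.
pose g k := r (sval (cid (qE (k%:R : rat)))).
have gE k : g k = f @^-1` `]-oo, (k%:R : R)[%classic.
  by rewrite /g; case: cid => n /= qn; rewrite /r qn ratr_nat.
apply: (@g_sigma_algebra_measure_unique _ R T G _ g) => //.
- by move=> _ [n ->].
- by move=> k; rewrite /g; exists (sval (cid (qE (k%:R : rat)))).
- apply/seteqP; split => // t _; exists (Num.trunc `|f t|).+1 => //.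
  rewrite gE /= in_itv/=; apply: le_lt_trans (ler_norm _) _.
  exact: Num.Theory.truncnS_gt.
- move=> _ _ [n ->] [n' ->].
  have -> : r n `&` r n' = if q n <= q n' then r n else r n'.
    have [qq|qq] := leP (q n) (q n'); apply/seteqP; split => t.
    - by case.
    - rewrite /r/= !in_itv/= => h; split => //.
      by apply: lt_le_trans h _; rewrite ler_rat.
    - by case.
    - rewrite /r/= !in_itv/= => h; split => //.
      by apply: lt_trans h _; rewrite ltr_rat.
  by case: ifP => _; [exists n|exists n'].
- by move=> _ [n ->].
- move=> k; apply: le_lt_trans fin; rewrite le_measure ?inE//.
  by rewrite /g.
Qed.

Context d' (E : measurableType d') (rho : {measure set E -> \bar R})
  (stT : standard_measurable_space R T).

(** The exceptional null set may depend on [A] in the hypothesis; the countable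
    determining family makes it uniform. *)
Lemma ae_eq_kernel (k1 k2 : E -> {measure set T -> \bar R}) :
  {ae rho, forall x, (k1 x setT < +oo)%E} ->
  (forall A, measurable A -> {ae rho, forall x, k1 x A = k2 x A}) ->
  {ae rho, forall x, forall A, measurable A -> k1 x A = k2 x A}.
Proof.
move=> fin k12; have [r mr rE] := standard_countable_determining stT.
have : {ae rho, forall x, forall n, k1 x (r n) = k2 x (r n)}.
  by apply: ae_foralln => n; exact: k12.
by apply: filterS2 fin => x fx kx A mA; exact: rE.
Qed.

Lemma ae_eq_kernel_integral (k1 k2 : R.-ker E ~> T) :
  (\int[rho]_x k1 x setT < +oo)%E ->
  (forall A D, measurable A -> measurable D ->
    \int[rho]_(x in D) k1 x A = \int[rho]_(x in D) k2 x A)%E ->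
  {ae rho, forall x, forall A, measurable A -> k1 x A = k2 x A}.
Proof.
move=> fin k12.
have i1 A : measurable A -> rho.-integrable setT (k1 ^~ A).
  move=> mA; apply/integrableP; split; first exact: measurable_kernel.
  under eq_integral do rewrite gee0_abs//.
  apply: le_lt_trans fin; apply: ge0_le_integral => //.
  - exact: measurable_kernel.
  - exact: measurable_kernel.
  - by move=> x _; rewrite le_measure ?inE.
apply: ae_eq_kernel.
  have := integrable_ae measurableT (i1 _ measurableT).
  by apply: filterS => x /(_ I) h; rewrite -ge0_fin_numE.
move=> A mA.
have := @integral_ae_eq _ _ _ rho setT measurableT (k2 ^~ A) (k1 ^~ A) (i1 _ mA)
  (measurable_kernel _ _ mA) (fun D _ mD => k12 A D mA mD).
by apply: filterS => x /(_ I).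
Qed.

End determined_kernels.

(** * Uniqueness and reconstruction *)

Section recovery.
Context (R : realType) (H : completeNormedModType R) (ip : {dot H for idfun})
  (e : nat -> H) d1 (Omega : measurableType d1) (P : probability Omega R)
  d2 (T : measurableType d2) (mu : {finite_measure set T -> \bar R})
  (X : H -> {mfun_ P, Omega >-> R}) (Y : H -> {mfun_ mu, T >-> R}).
Context (normE : forall u : H, `|u| ^+ 2 = ip u u)
  (stT : standard_measurable_space R T) (gX : standard_gaussian X)
  (gY : generalized_function Y).

Lemma ae_law_value (Q : Rinf R -> Prop) :
  {ae law e X, forall x, Q x} -> {ae P, forall w, Q (value e X w)}.
Proof.
move=> [N [mN N0 QN]]; exists (value e X @^-1` N); split => //.
- by rewrite -[X in measurable X]setTI; exact: measurable_value.
- by move=> w /= nQ; apply: QN.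
Qed.

Lemma law_sum_setE D : law_sum e X Y D =
  (P \x mu)%E (snd @^-1` setT `&` value_sum e X Y @^-1` D).
Proof. by rewrite preimage_setT setTI. Qed.

Section kernel_of_gmc.
Context (M : R.-ker Omega ~> T) (m : R.-ker (Rinf R) ~> T).
Context (gmcM : gmc ip e X Y M)
  (meanM : forall A, measurable A -> mean_measure P M A = mu A)
  (mE : function_of_X e X M m).

(** The main identity, read on the space of values of [X]. *)
Lemma integral_law_kernel A D : measurable A -> measurable D ->
  (\int[law e X]_(x in D) m x A =
   (P \x mu) (snd @^-1` A `&` value_sum e X Y @^-1` D))%E.
Proof.
move=> mA mD; have mm : measurable_fun setT (m ^~ A) by exact: measurable_kernel.
have mv := @measurable_value _ _ e _ _ _ X.
rewrite -(gmc_law_set normE gX gY gmcM meanM mA mD) integral_mkcond.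
have -> : (\int[law e X]_x ((m ^~ A) \_ D) x =
    \int[P]_w (((m ^~ A) \_ D) \o value e X) w)%E.
  rewrite ge0_integral_distribution//.
    by apply/(measurable_restrictT _ mD)/measurable_funTS.
  by move=> x; apply: erestrict_ge0.
apply: ae_eq_integral => //.
- apply: measurableT_comp => //.
  by apply/(measurable_restrictT _ mD)/measurable_funTS.
- apply: emeasurable_funM; first exact: measurable_kernel.
  apply/measurable_EFinP.
  exact: measurableT_comp (measurable_indic mD) mv.
- by apply: filterS mE => w /= wE _; rewrite epatch_indic/= wE.
Qed.

Lemma integral_law_kernelT : (\int[law e X]_x m x setT < +oo)%E.
Proof.
by rewrite integral_law_kernel// -law_sum_setE ltey_eq fin_num_measure.
Qed.

Lemma law_sum_dominated : law_sum e X Y `<< law e X.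
Proof.
apply/null_content_dominatesP => D mD D0.
rewrite law_sum_setE -integral_law_kernel//; apply: null_set_integral => //.
by apply: measurable_funTS; exact: measurable_kernel.
Qed.

Lemma integrable_law_kernelT : (law e X).-integrable setT (m ^~ setT).
Proof.
apply/integrableP; split; first exact: measurable_kernel.
by under eq_integral do rewrite gee0_abs//; exact: integral_law_kernelT.
Qed.

Lemma ae_Radon_Nikodym : {ae law e X, forall x, m x setT =
  ('d (charge_of_finite_measure (law_sum e X Y)) '/d (law e X)) x}.
Proof.
have dom := law_sum_dominated.
have iRN := Radon_Nikodym_integrable
  (nu := charge_of_finite_measure (law_sum e X Y)) dom.
have := @integral_ae_eq _ _ _ (law e X) setT measurableT _ _
  integrable_law_kernelT (measurable_int _ iRN).
have h D : D `<=` setT -> measurable D ->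
    (\int[law e X]_(x in D) m x setT = \int[law e X]_(x in D)
      ('d (charge_of_finite_measure (law_sum e X Y)) '/d (law e X)) x)%E.
  by move=> _ mD; rewrite integral_law_kernel// -law_sum_setE
    -Radon_Nikodym_integral.
by move=> /(_ h); apply: filterS => x /(_ I).
Qed.

(** The law of [X + Y(t)] does not charge the set where its density vanishes, and
    the density is almost everywhere finite. *)
Lemma ae_mass_pos_lty : {ae law_sum e X Y, forall x, (0 < m x setT < +oo)%E}.
Proof.
have mm : measurable_fun setT (m ^~ setT) by exact: measurable_kernel.
have m0 : measurable [set x | m x setT == 0%E] by exact: kernel_measurable_eq_cst.
have my : measurable [set x | m x setT == +oo%E] by exact: kernel_measurable_eq_cst.
exists ([set x | m x setT == 0%E] `|` [set x | m x setT == +oo%E]); split.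
- exact: measurableU.
- rewrite null_set_setU//.
  + apply: (etrans (law_sum_setE _)).
    rewrite -integral_law_kernel//; apply: integral0_eq => x /=.
    by move=> /eqP.
  + have /null_content_dominatesP := law_sum_dominated; apply => //.
    apply/eqP; rewrite -measure_le0.
    have [N [mN N0 sN]] := integrable_ae measurableT integrable_law_kernelT.
    rewrite -N0; apply: le_measure; rewrite ?inE//.
    by move=> x /= /eqP xy; apply: sN => /(_ I); rewrite xy.
- move=> x /= /negP; rewrite negb_and -leNgt -leNgt => /orP[h|h].
    by left; rewrite -measure_le0.
  by right; rewrite leye_eq in h.
Qed.

Lemma ae_knormalize (Q : probability T R) : {ae law_sum e X Y, forall x A,
  measurable A -> (((fine (m x setT))^-1)%:E * m x A)%E = knormalize m Q x A}.
Proof.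
apply: filterS ae_mass_pos_lty => x /andP[m0 my] A mA.
by rewrite /knormalize/= /mnormalize (gt_eqF m0) (lt_eqF my)/= muleC.
Qed.

(** The law of [X + Y(t)] has density [m x setT], so that integrating the
    normalized kernel against it gives back [m]. *)
Lemma conditional_knormalize (Q : probability T R) :
  conditional_distribution (P \x mu)%E snd (value_sum e X Y) (knormalize m Q).
Proof.
move=> A D mA mD; rewrite -integral_law_kernel//.
have mk : measurable_fun setT (fun x => knormalize m Q x A).
  exact: (measurable_kernel (knormalize m Q)).
rewrite -[RHS]/(\int[law_sum e X Y]_(x in D) knormalize m Q x A)%E.
rewrite -(Radon_Nikodym_SigmaFinite.change_of_variables law_sum_dominated)//;
  last exact: measurable_funTS.
have iRN := Radon_Nikodym_SigmaFinite.f_integrable law_sum_dominated.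
apply: ae_eq_integral => //.
- by apply: measurable_funTS; exact: measurable_kernel.
- apply: measurable_funTS; apply: emeasurable_funM => //.
  exact: measurable_int iRN.
- have := ae_eq_Radon_Nikodym_SigmaFinite law_sum_dominated measurableT.
  have := integrable_ae measurableT integrable_law_kernelT.
  apply: filterS3 ae_Radon_Nikodym => x mRN /(_ I) xfin /(_ I) -> _.
  rewrite -mRN /knormalize/= /mnormalize; case: ifPn => [/orP[/eqP m0|/eqP my]|].
  + rewrite m0 mule0; apply/eqP; rewrite -measure_le0 -m0.
    by rewrite le_measure ?inE.
  + by rewrite my in xfin.
  + rewrite negb_or => /andP[m0 my].
    rewrite -[X in (_ = _ * X)%E](fineK xfin) -muleA -EFinM mulVf ?mule1//.
    by rewrite fine_eq0.
Qed.

(** Two conditional distributions have the same integrals over every set [D], so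
    [k] agrees with the normalization of [m]; the default measure given to
    [knormalize] is used on a null set only. *)
Lemma conditional_distributionE (k : R.-pker (Rinf R) ~> T) :
  conditional_distribution (P \x mu)%E snd (value_sum e X Y) k ->
  {ae law_sum e X Y, forall x, forall A, measurable A ->
    (((fine (m x setT))^-1)%:E * m x A)%E = k x A}.
Proof.
move=> kE; pose k0 : R.-pker (Rinf R) ~> T := knormalize m (dirac point).
have k0E : conditional_distribution (P \x mu)%E snd (value_sum e X Y) k0.
  exact: conditional_knormalize.
have fin : (\int[law_sum e X Y]_x k0 x setT < +oo)%E.
  under eq_integral do rewrite prob_kernel.
  by rewrite integral_cst// mul1e ltey_eq fin_num_measure.
have := @ae_eq_kernel_integral _ _ _ _ _ (law_sum e X Y) stT k0 k fin.
have h A D : measurable A -> measurable D ->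
    (\int[law_sum e X Y]_(x in D) k0 x A = \int[law_sum e X Y]_(x in D) k x A)%E.
  by move=> mA mD; rewrite -[LHS]k0E// -[RHS]kE.
move=> /(_ h); apply: filterS2 (ae_knormalize (dirac point)) => x xE x0 A mA.
by rewrite xE// x0.
Qed.

End kernel_of_gmc.

Lemma gmc_unique (M M' : R.-ker Omega ~> T) :
  gmc ip e X Y M -> (forall A, measurable A -> mean_measure P M A = mu A) ->
  gmc ip e X Y M' -> (forall A, measurable A -> mean_measure P M' A = mu A) ->
  as_equal P M M'.
Proof.
move=> gM meanM gM' meanM'.
have [_ [m mE _]] := gM; have [_ [m' mE' _]] := gM'.
have h A D : measurable A -> measurable D ->
    (\int[law e X]_(x in D) m x A = \int[law e X]_(x in D) m' x A)%E.
  by move=> mA mD; rewrite (integral_law_kernel gM meanM mE)//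
    (integral_law_kernel gM' meanM' mE').
have := ae_law_value (ae_eq_kernel_integral stT (integral_law_kernelT gM meanM mE) h).
apply: filterS3 mE mE' => w mE mE' mm A mA.
by rewrite mE// mm// mE'.
Qed.

End recovery.

Theorem corollary18 (R : realType) (H : completeNormedModType R)
    (ip : {dot H for idfun}) (e : nat -> H)
    (dO : measure_display) (Omega : measurableType dO) (P : probability Omega R)
    (dT : measure_display) (T : measurableType dT)
    (mu : {finite_measure set T -> \bar R})
    (X : H -> {mfun_ P, Omega >-> R}) (Y : H -> {mfun_ mu, T >-> R}) :
  (forall u : H, `|u| ^+ 2 = ip u u) ->
  orthonormal_basis ip e ->
  standard_probability_space P ->
  standard_measurable_space R T ->
  standard_gaussian X ->
  generalized_function Y ->
  (forall M M' : R.-ker Omega ~> T,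
     gmc ip e X Y M -> subcritical P M ->
     (forall A, measurable A -> mean_measure P M A = mu A) ->
     gmc ip e X Y M' -> subcritical P M' ->
     (forall A, measurable A -> mean_measure P M' A = mu A) ->
     as_equal P M M') /\
  (forall (M : R.-ker Omega ~> T) (m : R.-ker (Rinf R) ~> T),
     gmc ip e X Y M -> subcritical P M ->
     (forall A, measurable A -> mean_measure P M A = mu A) ->
     function_of_X e X M m ->
     [/\ law_sum e X Y `<< law e X,
         {ae P, forall w, M w setT =
           ('d (charge_of_finite_measure (law_sum e X Y)) '/d (law e X))
             (value e X w)},
         (exists k : R.-pker (Rinf R) ~> T,
           conditional_distribution (P \x mu)%E snd (value_sum e X Y) k) &
         forall k : R.-pker (Rinf R) ~> T,
           conditional_distribution (P \x mu)%E snd (value_sum e X Y) k ->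
           {ae law_sum e X Y, forall x, forall A, measurable A ->
             (((fine (m x setT))^-1)%:E * m x A)%E = k x A}]).
Proof.
move=> normE _ _ stT gX gY; split=> [M M' gM _ meanM gM' _ meanM'|].
  exact: (gmc_unique normE stT gX gY gM meanM gM' meanM').
move=> M m gM _ meanM mE; split.
- exact: (law_sum_dominated normE gX gY gM meanM mE).
- have := ae_law_value (ae_Radon_Nikodym normE gX gY gM meanM mE).
  by apply: filterS2 mE => w wE <-; rewrite wE.
- exists (knormalize m (dirac point)).
  exact: (conditional_knormalize normE gX gY gM meanM mE).
- exact: (conditional_distributionE normE stT gX gY gM meanM mE).
Qed.
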